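(* Let $A$ be a ring with involution $*$, let $n\ge1$, let $F$ be a field, and let $P=C\rtimes L$ and $V(D,\lambda)$ be as in the context. Take $D=\{1,\dots,n\}$. (1) For every choice function $\lambda$ assigning to each $i\in D$ a left admissible linear character $\lambda_i:A^+\to F^*$, the module $V(D,\lambda)$ is an irreducible $P$-module of degree $|A|^{n(n-1)/2}$, and this number is the index in $P$ of the normal abelian subgroup $C$. If the map $A\to R=\{r\in A\mid r^*=r\}$, $a\mapsto a+a^*$, is surjective, then two such choice functions $\lambda,\lambda'$ with $\lambda_i|_R\ne\lambda'_i|_R$ for some $i\in D$ give non-isomorphic $P$-modules. (2) If $A$ is finite and $F=\mathbb{C}$, then for every such choice function $\lambda$ the degree $|A|^{n(n-1)/2}$ of $V(D,\lambda)$ is the highest possible degree of an irreducible complex $P$-module.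
   Context: $A$ is a ring with $1\neq 0$, not necessarily finite or commutative, with an involution $*$, i.e. an anti-automorphism of $A$ of order $\le 2$. For a square matrix $B$ over $A$, $(B^* )_{ij}=(B_{ji})^*$. $H_n(A)$ is the additive group of $n\times n$ matrices $S$ over $A$ with $S^*=S$, and $\mathcal{U}_n(A)$ is the group of upper triangular $n\times n$ matrices over $A$ with 1's on the diagonal. $V$ is a free right $A$-module with basis $u_1,\dots,u_n,v_1,\dots,v_n$, and $h:V\times V\to A$ is the skew-hermitian form (linear in the second variable, $h(v,u)=-h(u,v)^*$) with $h(u_i,u_j)=h(v_i,v_j)=0$, $h(u_i,v_j)=\delta_{ij}$, $h(v_i,u_j)=-\delta_{ij}$. $U$ is the subgroup of $\mathrm{GL}(V_A)$ preserving $h$. $M$ and $N$ are the $A$-spans of $u_1,\dots,u_n$ and of $v_1,\dots,v_n$. $C$ is the pointwise stabilizer of $M$ in $U$; its elements are those with matrix $\begin{pmatrix}1_n&S\\0&1_n\end{pmatrix}$, $S\in H_n(A)$, in the given basis. $L$ is the subgroup of $U$ of all elements with matrix $\begin{pmatrix}Y&0\\0&(Y^{-1})^*\end{pmatrix}$, $Y\in\mathcal{U}_n(A)$. $P=C\rtimes L$. All modules are over $F$. A linear character $\lambda:A^+\to F^*$ is a group homomorphism from the additive group of $A$; it is left admissible if the kernel of $\lambda^\sharp:A^+\to F^*$, $\lambda^\sharp(\alpha)=\lambda(\alpha+\alpha^* )$, contains no left ideals of $A$ other than $(0)$. For $v\in N$, $L_v$ is the stabilizer of $v$ in $L$, and $\chi_{v,\lambda}:C\rtimes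 L_v\to F^*$ is the linear character $\chi_{v,\lambda}(g)=\lambda(h(gv,v))$. For $1\le i\le n$, $W_i$ is the 1-dimensional $C\rtimes L_{v_i}$-module on which $C\rtimes L_{v_i}$ acts via $\chi_{v_i,\lambda}$, and $V_{i,\lambda}=\mathrm{ind}_{C\rtimes L_{v_i}}^{P}W_i$. For non-empty $D\subseteq\{1,\dots,n\}$ and a choice function $\lambda$ assigning to each $i\in D$ a left admissible linear character $\lambda_i$, $V(D,\lambda)=\bigotimes_{i\in D}V_{i,\lambda_i}$. Degree means dimension over $F$ (a cardinal number). *)

(* Defs.v *)
From HB Require Import structures.
From mathcomp Require Import all_boot all_order all_algebra.
From mathcomp Require Import finmap monalg.
From mathcomp Require Import boolp classical_sets functions cardinality reals.
From mathcomp Require Import complex.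

Set Implicit Arguments.
Unset Strict Implicit.
Unset Printing Implicit Defensive.

Import GRing.Theory.
Local Open Scope classical_set_scope.
Local Open Scope card_scope.
Local Open Scope ring_scope.

Section LinearAlgebra.
Variables (F : fieldType) (V : lmodType F).

Definition is_subspace (W : set V) : Prop :=
  W 0 /\ forall (a : F) x y, W x -> W y -> W (a *: x + y).

Definition lspan (S : set V) : set V :=
  [set x | forall W, is_subspace W -> S `<=` W -> W x].

Definition lin_indep (B : set V) : Prop :=
  forall (k : nat) (x : 'I_k -> V) (c : 'I_k -> F),
    injective x -> (forall i, B (x i)) -> \sum_i c i *: x i = 0 ->
    forall i, c i = 0.

Definition is_basis (B : set V) : Prop := lin_indep B /\ lspan B = setT.

(* dim V = |X| and dim V <= |X|, as cardinal numbers. *)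
Definition dim_eq (T : Type) (X : set T) : Prop :=
  exists B : set V, is_basis B /\ B #= X.
Definition dim_le (T : Type) (X : set T) : Prop :=
  exists B : set V, is_basis B /\ B #<= X.

Lemma lspan_subspace S : is_subspace (lspan S).
Proof.
split; first by move=> W [].
by move=> a x y Sx Sy W sW SW; apply: sW.2; [apply: Sx|apply: Sy].
Qed.

Lemma lspan_sub S : S `<=` lspan S.
Proof. by move=> x Sx W _; apply. Qed.

Definition lspan_pred (S : set V) : {pred V} := fun x => `[< lspan S x >].

Fact lspan_submod S : submod_closed (lspan_pred S).
Proof.
have [S0 SD] := lspan_subspace S; split.
  by rewrite unfold_in; apply/asboolP.
move=> a x y; rewrite !unfold_in => /asboolP Sx /asboolP Sy.
by apply/asboolP; apply: SD.
Qed.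

HB.instance Definition _ S :=
  GRing.isSubmodClosed.Build F V (lspan_pred S) (lspan_submod S).

Definition quotient_by (S : set V) := Quotient.quot (lspan_pred S).

HB.instance Definition _ S := GRing.Zmodule.on (quotient_by S).

Section Quotient.
Variable S : set V.
Local Notation Q := (quotient_by S).

Definition qclass (x : V) : Q := (\pi_(Quotient.quot (lspan_pred S)) x)%qT.

Lemma qclassP x y : qclass x = qclass y <-> lspan S (x - y).
Proof.
rewrite /qclass; split=> [/eqP|xy].
  by rewrite -Quotient.idealrBE => /asboolP.
by apply/eqP; rewrite -Quotient.idealrBE; apply/asboolP.
Qed.

Lemma qclassD x y : qclass (x + y) = qclass x + qclass y.
Proof. exact: (@raddfD _ _ (\pi_(Quotient.quot (lspan_pred S)))%qT). Qed.

Definition qrepr (q : Q) : V := repr (q : Quotient.quot (lspan_pred S)).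

Lemma qreprK q : qclass (qrepr q) = q.
Proof. exact: reprK. Qed.

Lemma qreprP x : lspan S (qrepr (qclass x) - x).
Proof. by apply/qclassP; rewrite qreprK. Qed.

Definition qscale (a : F) (q : Q) : Q := qclass (a *: qrepr q).

Lemma qscaleE a x : qscale a (qclass x) = qclass (a *: x).
Proof.
apply/qclassP; rewrite -scalerBr -[_ *: _]addr0.
have [S0 SD] := lspan_subspace S.
by apply: SD => //; apply: qreprP.
Qed.

Fact qscaleA a b q : qscale a (qscale b q) = qscale (a * b) q.
Proof. by rewrite -[q]qreprK !qscaleE scalerA. Qed.
Fact qscale1 : left_id 1 qscale.
Proof. by move=> q; rewrite -[q]qreprK !qscaleE scale1r. Qed.
Fact qscaleDr : right_distributive qscale +%R.
Proof.
move=> a q r; rewrite -[q]qreprK -[r]qreprK.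
by rewrite -qclassD !qscaleE scalerDr qclassD.
Qed.
Fact qscaleDl q : {morph qscale^~ q : a b / a + b}.
Proof. by move=> a b; rewrite -[q]qreprK !qscaleE scalerDl qclassD. Qed.

HB.instance Definition _ := GRing.Zmodule_isLmodule.Build F (quotient_by S)
  qscaleA qscale1 qscaleDr qscaleDl.

Lemma qclassZ a x : qclass (a *: x) = a *: qclass x.
Proof. exact/esym/qscaleE. Qed.

End Quotient.
End LinearAlgebra.

(* {malg F[X]} is used only as the free F-vector space on the type X. *)
Section FreeModule.
Variables (F : fieldType) (X : choiceType).

Definition fgen (x : X) : {malg F[X]} := mkmalgU x 1.

End FreeModule.

Section FreeMap.
Variables (F : fieldType) (X Y : choiceType) (f : X -> Y).

Definition fmapX (m : {malg F[X]}) : {malg F[Y]} :=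
  \sum_(k <- msupp m) mcoeff k m *: fgen F (f k).

Lemma fmapXw (m : {malg F[X]}) (d : {fset X}) : (msupp m `<=` d)%fset ->
  fmapX m = \sum_(k <- d) mcoeff k m *: fgen F (f k).
Proof.
move=> md; apply: big_fset_incl => // k _.
by rewrite -mcoeff_eq0 => /eqP ->; rewrite scale0r.
Qed.

Lemma fmapX_linear : linear fmapX.
Proof.
move=> a m1 m2.
pose d := (msupp m1 `|` msupp m2 `|` msupp (a *: m1 + m2))%fset.
rewrite (@fmapXw m1 d) ?(@fmapXw m2 d) ?(@fmapXw _ d); last first.
- by rewrite /d -fsetUA fsubsetUl.
- by rewrite /d fsetUAC fsubsetUr.
- exact: fsubsetUr.
rewrite scaler_sumr -big_split /=; apply: eq_bigr => k _.
by rewrite mcoeffD mcoeffZ scalerDl scalerA.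
Qed.

HB.instance Definition _ :=
  GRing.isLinear.Build F {malg F[X]} {malg F[Y]} _ fmapX fmapX_linear.

Lemma fmapX_gen x : fmapX (fgen F x) = fgen F (f x).
Proof.
rewrite /fmapX /fgen msuppU oner_eq0 big_seq_fset1 mcoeffUU.
by rewrite scale1r.
Qed.

End FreeMap.

Section GModules.
Variables (F : fieldType) (G : groupType).

Record gmodule := GModule {
  gspace :> lmodType F;
  gact : G -> gspace -> gspace;
  gact_linear : forall g, linear (gact g);
  gact1 : forall x, gact 1%g x = x;
  gactM : forall g h x, gact (g * h)%g x = gact g (gact h x)
}.

Definition irreducible (V : gmodule) : Prop :=
  (exists x : V, x != 0) /\
  forall W : set V, is_subspace W ->
    (forall g x, W x -> W (gact g x)) -> W = [set 0] \/ W = setT.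

Definition isomorphic (V W : gmodule) : Prop :=
  exists f : V -> W, [/\ linear f, bijective f &
    forall g x, f (gact g x) = gact g (f x)].

(* The G-module with generators X and linear relations R, on which G acts by
   permuting the generators. *)
Section Presented.
Variables (X : choiceType) (R : set {malg F[X]}) (a : G -> X -> X).
Hypothesis a1 : forall x, a 1%g x = x.
Hypothesis aM : forall g h x, a (g * h)%g x = a g (a h x).
Hypothesis aR : forall g r, R r -> R (fmapX (a g) r).

Local Notation Q := (quotient_by R).

Definition pact (g : G) (q : Q) : Q := qclass R (fmapX (a g) (qrepr q)).

Lemma fmapX_lspan g m : lspan R m -> lspan R (fmapX (a g) m).
Proof.
move=> Rm W [W0 WD] RW.
have: is_subspace [set m' | W (fmapX (a g) m')].
  split=> [|b x y Wx Wy] /=; first by rewrite linear0.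
  by rewrite linearP; apply: WD.
by move/Rm; apply=> r /(aR g)/RW.
Qed.

Lemma pactE g m : pact g (qclass R m) = qclass R (fmapX (a g) m).
Proof. by apply/qclassP; rewrite -linearB; apply: fmapX_lspan; apply: qreprP. Qed.

Lemma pact_linear g : linear (pact g).
Proof.
move=> b q r; rewrite -[q]qreprK -[r]qreprK.
by rewrite -qclassZ -qclassD !pactE linearP qclassD qclassZ.
Qed.

Lemma fmapX_act1 (m : {malg F[X]}) : fmapX (a 1%g) m = m.
Proof.
rewrite [RHS]monalgE; apply: eq_bigr => k _.
by rewrite a1; apply/malgP=> k'; rewrite mcoeffZ !mcoeffU mulrnAr mulr1.
Qed.

Lemma fmapX_actM g h (m : {malg F[X]}) :
  fmapX (a (g * h)%g) m = fmapX (a g) (fmapX (a h) m).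
Proof.
rewrite {3}/fmapX linear_sum.
apply: eq_bigr => k _.
by rewrite linearZ /= fmapX_gen aM.
Qed.

Lemma pact1 q : pact 1%g q = q.
Proof. by rewrite /pact fmapX_act1 qreprK. Qed.

Lemma pactM g h q : pact (g * h)%g q = pact g (pact h q).
Proof. by rewrite -[q]qreprK !pactE fmapX_actM. Qed.

Definition presented : gmodule := GModule pact_linear pact1 pactM.

End Presented.
End GModules.

(* ind_H^G W = F[G] (x)_{F[H]} W, for H a subgroup of G and W an H-module: the
   tensor product is presented by the generators g (x) w = (g, w).  Only the
   action on W of the elements of H matters. *)
Section Induced.
Variables (F : fieldType) (G : groupType) (H : set G).
Variables (W : lmodType F) (actW : G -> W -> W).

Local Notation X := (G * W)%type.

Definition ind_rel : set {malg F[X]} := [set r |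
  (exists (g : G) (a : F) (x y : W),
     r = fgen F ((g, a *: x + y) : X)
         - (a *: fgen F ((g, x) : X) + fgen F ((g, y) : X))) \/
  (exists (g h : G) (x : W), H h /\
     r = fgen F (((g * h)%g, x) : X) - fgen F ((g, actW h x) : X))].

Definition ind_gen_act (g : G) (p : X) : X := ((g * p.1)%g, p.2).

Fact ind_gen_act1 p : ind_gen_act 1%g p = p.
Proof. by case: p => g w; rewrite /ind_gen_act mul1g. Qed.

Fact ind_gen_actM g h p :
  ind_gen_act (g * h)%g p = ind_gen_act g (ind_gen_act h p).
Proof. by rewrite /ind_gen_act /= mulgA. Qed.

Fact ind_gen_act_rel g r : ind_rel r -> ind_rel (fmapX (ind_gen_act g) r).
Proof.
case=> [[k [a [x [y ->]]]]|[k [h [x [Hh ->]]]]]; [left|right].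
  exists (g * k)%g, a, x, y.
  by rewrite linearB linearD linearZ /= !fmapX_gen.
exists (g * k)%g, h, x; split=> //.
by rewrite linearB /= !fmapX_gen /ind_gen_act /= mulgA.
Qed.

Definition induced : gmodule F G :=
  presented ind_gen_act1 ind_gen_actM ind_gen_act_rel.

End Induced.

(* The tensor product over F of a finite family of G-modules, presented by the
   pure tensors and the multilinear relations, with the diagonal action of G. *)
Section Tensor.
Variables (F : fieldType) (G : groupType) (I : finType).
Variable V : I -> gmodule F G.

Local Notation X := {dffun forall i, V i}.

Definition tensor_rel : set {malg F[X]} := [set r |
  exists (i : I) (a : F) (x y z : X),
    [/\ z i = a *: x i + y i,
        forall j, j != i -> z j = x j /\ z j = y j &
        r = fgen F z - (a *: fgen F x + fgen F y)]].

Definition tensor_gen_act (g : G) (x : X) : X := [ffun i => gact g (x i)].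

Fact tensor_gen_act1 x : tensor_gen_act 1%g x = x.
Proof. by apply/ffunP=> i; rewrite ffunE gact1. Qed.

Fact tensor_gen_actM g h x :
  tensor_gen_act (g * h)%g x = tensor_gen_act g (tensor_gen_act h x).
Proof. by apply/ffunP=> i; rewrite !ffunE gactM. Qed.

Fact tensor_gen_act_rel g r :
  tensor_rel r -> tensor_rel (fmapX (tensor_gen_act g) r).
Proof.
case=> i [a [x [y [z [zi zj ->]]]]].
exists i, a, (tensor_gen_act g x), (tensor_gen_act g y), (tensor_gen_act g z).
split; first by rewrite !ffunE zi gact_linear.
  by move=> j /zj[zx zy]; rewrite !ffunE -zx -zy.
by rewrite linearB linearD linearZ /= !fmapX_gen.
Qed.

Definition tensor : gmodule F G :=
  presented tensor_gen_act1 tensor_gen_actM tensor_gen_act_rel.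

End Tensor.

Section Subgroups.
Variable G : groupType.
Implicit Types (X Y N : set G).

Definition mulset X Y : set G := [set z | exists x y, [/\ X x, Y y & z = (x * y)%g]].

Definition normal_abelian_subgroup N : Prop :=
  [/\ N 1%g, forall x y, N x -> N y -> N (x * y^-1)%g,
      forall g x, N x -> N (g * x * g^-1)%g &
      forall x y, N x -> N y -> (x * y = y * x)%g].

Definition lcosets N : set (set G) :=
  [set X | exists g, X = [set (g * x)%g | x in N]].

End Subgroups.

Section GeneralLinear.
Variables (A : nzRingType) (m : nat).

Definition mx_inverse (g g' : 'M[A]_m) : Prop :=
  g *m g' = 1%:M /\ g' *m g = 1%:M.

Definition mx_invertible (g : 'M[A]_m) : bool := `[< exists g', mx_inverse g g' >].

Record GL : Type := MkGL { glval :> 'M[A]_m; glvalP : mx_invertible glval }.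

HB.instance Definition _ := [isSub for glval].
HB.instance Definition _ := [Choice of GL by <:].

Implicit Types g h : GL.

Fact gl_mul_subproof g h : mx_invertible (glval g *m glval h).
Proof.
case: g h => g /= /asboolP[g' [gg' g'g]] [h /= /asboolP[h' [hh' h'h]]].
apply/asboolP; exists (h' *m g'); split.
  by rewrite mulmxA -(mulmxA g) hh' mulmx1.
by rewrite mulmxA -(mulmxA h') g'g mulmx1.
Qed.

Fact gl_one_subproof : mx_invertible 1%:M.
Proof. by apply/asboolP; exists 1%:M; rewrite /mx_inverse mulmx1. Qed.

Definition gl_mul g h := MkGL (gl_mul_subproof g h).
Definition gl_one := MkGL gl_one_subproof.

Fact gl_inv_exists g : exists g' : 'M[A]_m, mx_inverse (glval g) g'.
Proof. exact/asboolP/glvalP. Qed.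

Definition gl_invmx g : 'M[A]_m := projT1 (cid (gl_inv_exists g)).

Fact gl_invmxP g : mx_inverse (glval g) (gl_invmx g).
Proof. by rewrite /gl_invmx; case: cid. Qed.

Fact gl_inv_subproof g : mx_invertible (gl_invmx g).
Proof. by have [gg' g'g] := gl_invmxP g; apply/asboolP; exists (glval g). Qed.

Definition gl_inv g := MkGL (gl_inv_subproof g).

Fact gl_mulA : associative gl_mul.
Proof. by move=> x y z; apply: val_inj; apply: mulmxA. Qed.
Fact gl_mul1 : left_id gl_one gl_mul.
Proof. by move=> x; apply: val_inj; apply: mul1mx. Qed.
Fact gl_mulr1 : right_id gl_one gl_mul.
Proof. by move=> x; apply: val_inj; apply: mulmx1. Qed.
Fact gl_mulV : left_inverse gl_one gl_inv gl_mul.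
Proof. by move=> x; apply: val_inj; apply: (gl_invmxP x).2. Qed.
Fact gl_mulrV : right_inverse gl_one gl_inv gl_mul.
Proof. by move=> x; apply: val_inj; apply: (gl_invmxP x).1. Qed.

HB.instance Definition _ :=
  isGroup.Build GL gl_mulA gl_mul1 gl_mulr1 gl_mulV gl_mulrV.

Lemma glM g h : glval (g * h)%g = glval g *m glval h. Proof. by []. Qed.
Lemma gl1 : glval (1%g : GL) = 1%:M. Proof. by []. Qed.
Lemma glVmul g : glval (g^-1)%g *m glval g = 1%:M.
Proof. by rewrite -glM mulVg. Qed.
Lemma glmulV g : glval g *m glval (g^-1)%g = 1%:M.
Proof. by rewrite -glM mulgV. Qed.

End GeneralLinear.

Record ring_involution (A : nzRingType) := RingInvolution {
  ristar :> A -> A;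
  ristarD : forall a b, ristar (a + b) = ristar a + ristar b;
  ristarM : forall a b, ristar (a * b) = ristar b * ristar a;
  ristarK : involutive ristar
}.

Section Unitary.
Variables (A : nzRingType) (star : ring_involution A) (n : nat).

Definition starmx (p q : nat) (B : 'M[A]_(p, q)) : 'M[A]_(q, p) :=
  \matrix_(i, j) star (B j i).

(* V is the right A-module 'cV[A]_(n + n), a vector being the column of its
   coordinates in the basis u_1, .., u_n, v_1, .., v_n; g : GL A (n + n) acts on
   V by x |-> g *m x. *)
Local Notation V := 'cV[A]_(n + n).

Definition rscale (x : V) (a : A) : V := map_mx (fun b => b * a) x.

Definition ubasis (i : 'I_n) : V := delta_mx (lshift n i) 0.
Definition vbasis (i : 'I_n) : V := delta_mx (rshift n i) 0.

(* h(x, y) = sum_i (x_(u_i)^* y_(v_i) - x_(v_i)^* y_(u_i)) *)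
Definition hform (x y : V) : A :=
  (starmx (usubmx x) *m dsubmx y - starmx (dsubmx x) *m usubmx y) 0 0.

Definition Mspan : set V :=
  [set x | exists a : 'I_n -> A, x = \sum_i rscale (ubasis i) (a i)].

Definition Ugrp : set (GL A (n + n)) :=
  [set g | forall x y : V, hform (glval g *m x) (glval g *m y) = hform x y].

Definition Cgrp : set (GL A (n + n)) :=
  [set g | Ugrp g /\ forall x, Mspan x -> glval g *m x = x].

Definition unitriangular (Y : 'M[A]_n) : Prop :=
  forall i j : 'I_n, (j <= i)%N -> Y i j = (i == j)%:R.

Definition Lgrp : set (GL A (n + n)) :=
  [set g | Ugrp g /\ exists Y : GL A n, unitriangular (glval Y) /\
     glval g = block_mx (glval Y) 0 0 (starmx (glval (Y^-1)%g))].

Definition Lstab (v : V) : set (GL A (n + n)) :=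
  [set g | Lgrp g /\ glval g *m v = v].

Lemma ristar0 : star 0 = 0.
Proof. by apply: (addrI (star 0)); rewrite -ristarD !addr0. Qed.

Lemma ristar1 : star 1 = 1.
Proof. by have := ristarM star (star 1) 1; rewrite mulr1 ristarK mulr1. Qed.

Lemma ristarN a : star (- a) = - star a.
Proof. by apply: (addrI (star a)); rewrite -ristarD !subrr ristar0. Qed.

Lemma ristar_sum I (r : seq I) (E : I -> A) :
  star (\sum_(i <- r) E i) = \sum_(i <- r) star (E i).
Proof.
elim: r => [|i r IH]; first by rewrite !big_nil ristar0.
by rewrite !big_cons ristarD IH.
Qed.

Lemma starmxM p q r (B : 'M[A]_(p, q)) (D : 'M[A]_(q, r)) :
  starmx (B *m D) = starmx D *m starmx B.
Proof.
apply/matrixP=> i j; rewrite !mxE ristar_sum; apply: eq_bigr => k _.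
by rewrite !mxE ristarM.
Qed.

Lemma starmxK p q (B : 'M[A]_(p, q)) : starmx (starmx B) = B.
Proof. by apply/matrixP=> i j; rewrite !mxE ristarK. Qed.

(* The next five lemmas characterise h. *)
Lemma hform_linr x y z a :
  hform x (rscale y a + z) = hform x y * a + hform x z.
Proof.
rewrite /hform !mxE mulrDl mulNr !mulr_suml -!sumrN -!big_split /=.
by apply: eq_bigr => i _; rewrite !mxE !mulrDr !mulrA opprD addrACA.
Qed.

Lemma hform_skew x y : hform y x = - star (hform x y).
Proof.
rewrite /hform !mxE ristarD ristarN !ristar_sum opprB; congr (_ - _);
  by apply: eq_bigr => i _; rewrite !mxE ristarM ristarK.
Qed.

Lemma hform_uu i j : hform (ubasis i) (ubasis j) = 0.
Proof.
rewrite /hform !mxE !big1 ?subr0 // => k _; rewrite !mxE /=.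
  by rewrite eq_rlshift ristar0 mul0r.
by rewrite eq_rlshift mulr0.
Qed.

Lemma hform_vv i j : hform (vbasis i) (vbasis j) = 0.
Proof.
rewrite /hform !mxE !big1 ?subr0 // => k _; rewrite !mxE /=.
  by rewrite eq_lrshift mulr0.
by rewrite eq_lrshift ristar0 mul0r.
Qed.

Lemma hform_uv i j : hform (ubasis i) (vbasis j) = (i == j)%:R.
Proof.
rewrite /hform !mxE [X in _ - X]big1 ?subr0 => [|k _]; last first.
  by rewrite !mxE eq_rlshift ristar0 mul0r.
rewrite (bigD1 i) //= big1 ?addr0 => [|k ki]; rewrite !mxE.
  by rewrite !eqxx /= ristar1 mul1r eq_rshift andbT.
by rewrite eq_lshift (negPf ki) ristar0 mul0r.
Qed.

Local Open Scope group_scope.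

Fact Ugrp1 : Ugrp 1.
Proof. by move=> x y; rewrite gl1 !mul1mx. Qed.

Fact UgrpM x y : Ugrp x -> Ugrp y -> Ugrp (x * y).
Proof. by move=> Ux Uy a b; rewrite glM -!mulmxA Ux Uy. Qed.

Fact UgrpV x : Ugrp x -> Ugrp x^-1.
Proof. by move=> Ux a b; rewrite -Ux !mulmxA !glmulV !mul1mx. Qed.

Fact Cgrp1 : Cgrp 1.
Proof. by split=> [|x _]; [apply: Ugrp1|rewrite gl1 mul1mx]. Qed.

Fact CgrpM x y : Cgrp x -> Cgrp y -> Cgrp (x * y).
Proof.
move=> [Ux Mx] [Uy My]; split; first exact: UgrpM.
by move=> z Mz; rewrite glM -mulmxA My // Mx.
Qed.

Fact CgrpV x : Cgrp x -> Cgrp x^-1.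
Proof.
move=> [Ux Mx]; split; first exact: UgrpV.
by move=> z Mz; rewrite -{1}(Mx z Mz) mulmxA glVmul mul1mx.
Qed.

Fact unitriangular_inv (Y Y' : 'M[A]_n) :
  Y *m Y' = 1%:M -> unitriangular Y -> unitriangular Y'.
Proof.
move=> YY' Yu.
suff H : forall d (i j : 'I_n), (n - i <= d)%N -> (j <= i)%N ->
    Y' i j = (i == j)%:R%R by move=> i j; apply: (H n); apply: leq_subr.
elim=> [|d IH] i j nd ji.
  by move: nd; rewrite leqn0 subn_eq0 leqNgt ltn_ord.
have := congr1 (fun B : 'M[A]_n => B i j) YY'.
rewrite !mxE (bigD1 i) //= Yu // eqxx mul1r big1 ?addr0 // => k ki.
have [ltki|ltik] := leqP k i.
  by rewrite Yu // eq_sym (negPf ki) mul0r.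
rewrite IH; last 2 first.
- by rewrite -ltnS (leq_trans _ nd) // ltn_sub2l.
- exact: (leq_trans ji (ltnW ltik)).
rewrite -val_eqE /= gtn_eqF ?mulr0 //.
exact: leq_ltn_trans ltik.
Qed.

Fact unitriangularM (Y Z : 'M[A]_n) :
  unitriangular Y -> unitriangular Z -> unitriangular (Y *m Z).
Proof.
move=> Yu Zu i j ji; rewrite mxE (bigD1 i) //= Yu // eqxx mul1r Zu //.
rewrite big1 ?addr0 // => k ki.
have [leki|ltik] := leqP k i; first by rewrite Yu // eq_sym (negPf ki) mul0r.
rewrite Zu; last exact: (leq_trans ji (ltnW ltik)).
rewrite -val_eqE /= gtn_eqF ?mulr0 //.
exact: leq_ltn_trans ltik.
Qed.

Fact starmx1 m : starmx (1%:M : 'M[A]_m) = 1%:M.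
Proof.
by apply/matrixP=> i j; rewrite !mxE eq_sym; case: eqP; rewrite ?ristar1 ?ristar0.
Qed.

Fact Lgrp1 : Lgrp 1.
Proof.
split; first exact: Ugrp1.
exists 1; split; first by move=> i j _; rewrite gl1 mxE.
by rewrite invg1 !gl1 starmx1 -scalar_mx_block.
Qed.

Fact LgrpM x y : Lgrp x -> Lgrp y -> Lgrp (x * y).
Proof.
move=> [Ux [Y [Yu xE]]] [Uy [Z [Zu yE]]]; split; first exact: UgrpM.
exists (Y * Z); split; first exact: unitriangularM.
rewrite glM xE yE mulmx_block !mul0mx !mulmx0 !addr0 !add0r.
by rewrite -starmxM -!glM invgM.
Qed.

Fact LgrpV x : Lgrp x -> Lgrp x^-1.
Proof.
move=> [Ux [Y [Yu xE]]]; split; first exact: UgrpV.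
exists Y^-1; split; first exact: (unitriangular_inv (glmulV Y)).
rewrite invgK -[LHS]mulmx1.
have <- : glval x *m block_mx (glval Y^-1) 0%R 0%R (starmx (glval Y)) = 1%:M.
  rewrite xE mulmx_block !mul0mx !mulmx0 !addr0 !add0r -starmxM !glmulV starmx1.
  by rewrite -scalar_mx_block.
by rewrite mulmxA glVmul mul1mx.
Qed.

Fact MspanP (x : V) : Mspan x <-> dsubmx x = 0%R.
Proof.
split=> [[a ->]|x0].
  apply/matrixP=> i j; rewrite !mxE summxE big1 // => k _.
  by rewrite !mxE eq_rlshift mul0r.
exists (fun i => x (lshift n i) 0); apply/matrixP=> k j.
rewrite ord1 summxE; case: (split_ordP k) => i -> /=; last first.
  rewrite big1 => [|l _]; last by rewrite !mxE eq_rlshift mul0r.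
  by move/matrixP/(_ i 0): x0; rewrite !mxE.
rewrite (bigD1 i) //= big1 => [|l li]; last first.
  by rewrite !mxE eq_lshift eq_sym (negPf li) mul0r.
by rewrite !mxE !eqxx mul1r addr0.
Qed.

Fact Lgrp_Mspan x z : Lgrp x -> Mspan z -> Mspan (glval x *m z).
Proof.
move=> [_ [Y [_ xE]]] /MspanP z0; apply/MspanP.
rewrite xE -[z]vsubmxK z0 mul_block_col col_mxKd.
by rewrite mul0mx mulmx0 addr0.
Qed.

Fact CgrpJ c l : Cgrp c -> Lgrp l -> Cgrp (l * c * l^-1).
Proof.
move=> [Uc Mc] Ll; have LVl := LgrpV Ll; split.
  by apply: UgrpM; [apply: UgrpM => //; case: Ll|case: LVl].
move=> z Mz; rewrite !glM -!mulmxA Mc ?mulmxA ?glmulV ?mul1mx //.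
exact: Lgrp_Mspan.
Qed.

Definition Pset : set (GL A (n + n)) := mulset Cgrp Lgrp.

Fact Pset_closed : group_closed (fun g : GL A (n + n) => `[< Pset g >]).
Proof.
split; first by rewrite unfold_in; apply/asboolP; exists 1, 1; split;
  [exact: Cgrp1|exact: Lgrp1|rewrite mulg1].
move=> x y; rewrite !unfold_in => /asboolP[c [l [Cc Ll ->]]].
move=> /asboolP[d [m [Cd Lm ->]]]; apply/asboolP.
exists (c * ((l * m^-1) * d^-1 * (l * m^-1)^-1)), (l * m^-1); split.
- by apply/CgrpM/CgrpJ/LgrpM/LgrpV => //; apply: CgrpV.
- exact/LgrpM/LgrpV.
- by set k := l * m^-1; rewrite -[RHS]mulgA mulgVK /k invgM !mulgA.
Qed.

(* The group P, whose elements are the products c * l. *)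
Record Pgrp : Type := MkP { pval :> GL A (n + n); pvalP : `[< Pset pval >] }.

HB.instance Definition _ := [isSub for pval].
HB.instance Definition _ := [Choice of Pgrp by <:].
HB.instance Definition _ :=
  SubChoice_isSubGroup.Build (GL A (n + n)) _ Pgrp Pset_closed.

Definition CinP : set Pgrp := [set g | Cgrp (pval g)].

(* The subgroup C L_v of P. *)
Definition CLstab (v : V) : set Pgrp :=
  [set g | mulset Cgrp (Lstab v) (pval g)].

Local Close Scope group_scope.

Section Characters.
Variable F : fieldType.

Definition linear_character (lam : A -> F) : Prop :=
  (forall a, lam a != 0) /\ (forall a b, lam (a + b) = lam a * lam b).

Definition left_ideal (I : set A) : Prop :=
  [/\ I 0, forall a b, I a -> I b -> I (a - b) & forall a b, I b -> I (a * b)].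

Definition left_admissible (lam : A -> F) : Prop :=
  linear_character lam /\
  forall I, left_ideal I -> (forall a, I a -> lam (a + star a) = 1) ->
    I = [set 0].

Definition chi (lam : A -> F) (v : V) (g : Pgrp) : F :=
  lam (hform (glval g *m v) v).

Definition Vi (lam : A -> F) (i : 'I_n) : gmodule F Pgrp :=
  induced (CLstab (vbasis i))
    (fun g (x : F^o) => chi lam (vbasis i) g * x : F^o).

(* Only the values of lam on D are used. *)
Definition VD (D : {set 'I_n}) (lam : 'I_n -> A -> F) : gmodule F Pgrp :=
  tensor (fun i : {i : 'I_n | i \in D} => Vi (lam (val i)) (val i)).

End Characters.
End Unitary.

Arguments CinP {A} star n.
Arguments left_admissible {A} star {F} lam.
Arguments VD {A} star {n F} D lam.

(* Main.v *)
From HB Require Import structures.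
Require Import Defs.
From mathcomp Require Import all_boot all_order all_algebra.
From mathcomp Require Import finmap monalg.
From mathcomp Require Import boolp classical_sets functions cardinality reals.
From mathcomp Require Import complex.
Local Open Scope classical_set_scope.
Local Open Scope card_scope.
Local Open Scope ring_scope.

Set Implicit Arguments.
Unset Strict Implicit.
Unset Printing Implicit Defensive.

Import GRing.Theory.

(** The module [V(D, lam)], with [D] the full index set, is generated by the
    single vector [e], the tensor product of the generators [1 (x) 1] of its
    factors.  The normal abelian group [C] acts on [e] by the character [mu] that
    sends [S] to the product of the [lam_i (S_ii)], and on the translate of [e]
    by [l] in [L] by the conjugate character.  If [X] is the lower unitriangular
    matrix of [l] on [N], this conjugate is the product of the
    [lam_i ((X^* S X)_ii)] ([chi_conj]).

    The translates of [e] by [L] span ([VD_gen_span]): each factor is spanned by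
    vectors indexed by the orbit of [v_i] under [L], and a choice of one vector in
    each of these orbits is the list of the columns of exactly one [X]
    ([common_translate]).  They are nonzero ([VD_gen_neq0]), and admissibility
    makes their characters pairwise distinct ([separation]).  Eigenvectors for
    distinct characters are linearly independent, and a subspace stable under [C]
    contains the component of each of its vectors on every eigenline
    ([eigen_split]).  So the translates form a basis indexed by [L], that is, by
    the cosets of [C], which gives the degree; a nonzero submodule contains one
    eigenline, hence all of them, as [L] permutes them transitively.  An
    isomorphism carries the character [mu] of one module to a conjugate of that of
    the other, and [mu_separation] then recovers each [lam_i] on the hermitian
    elements.

    For finite [A], commuting operators of finite order over an algebraically
    closed field have a common eigenvector ([common_eigenvector]).  In an
    irreducible module a common eigenvector of [C] generates, so its translates by
    coset representatives of [C] span, and the index of [C] bounds the degree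
    ([irreducible_dim_le]). *)

(** * Subspaces, linear extension and presented modules *)

Section Subspaces.
Variables (F : fieldType) (V : lmodType F) (W : set V).
Hypothesis sW : is_subspace W.

Lemma subspaceD x y : W x -> W y -> W (x + y).
Proof. by move=> Wx Wy; rewrite -[x]scale1r; apply: sW.2. Qed.

Lemma subspaceZ a x : W x -> W (a *: x).
Proof. by move=> Wx; rewrite -[_ *: _]addr0; apply: sW.2 => //; case: sW. Qed.

Lemma subspaceB x y : W x -> W y -> W (x - y).
Proof. by move=> Wx Wy; rewrite addrC -scaleN1r; apply: sW.2. Qed.

Lemma subspace_sum I (r : seq I) (P : pred I) (E : I -> V) :
  (forall i, P i -> W (E i)) -> W (\sum_(i <- r | P i) E i).
Proof.
move=> WE; elim/big_rec: _ => [|i x Pi Wx]; first by case: sW.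
by apply: subspaceD => //; apply: WE.
Qed.

Lemma subspaceZ_inv a x : a != 0 -> W (a *: x) -> W x.
Proof. by move=> a0 /(subspaceZ a^-1); rewrite scalerA mulVf // scale1r. Qed.

End Subspaces.

Lemma subspace0 (F : fieldType) (V : lmodType F) :
  is_subspace ([set 0] : set V).
Proof. by split=> // a x y /= -> ->; rewrite scaler0 addr0. Qed.

Section LinearExtension.
Variables (F : fieldType) (X : choiceType) (V : lmodType F) (f : X -> V).

Definition lin_ext (m : {malg F[X]}) : V :=
  \sum_(k <- msupp m) mcoeff k m *: f k.

Lemma lin_extw (m : {malg F[X]}) (d : {fset X}) : (msupp m `<=` d)%fset ->
  lin_ext m = \sum_(k <- d) mcoeff k m *: f k.
Proof.
move=> md; apply: big_fset_incl => // k _.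
by rewrite -mcoeff_eq0 => /eqP ->; rewrite scale0r.
Qed.

Lemma lin_ext_linear : linear lin_ext.
Proof.
move=> a m1 m2.
pose d := (msupp m1 `|` msupp m2 `|` msupp (a *: m1 + m2))%fset.
rewrite (@lin_extw m1 d) ?(@lin_extw m2 d) ?(@lin_extw _ d); last first.
- by rewrite /d -fsetUA fsubsetUl.
- by rewrite /d fsetUAC fsubsetUr.
- exact: fsubsetUr.
rewrite scaler_sumr -big_split /=; apply: eq_bigr => k _.
by rewrite mcoeffD mcoeffZ scalerDl scalerA.
Qed.

HB.instance Definition _ :=
  GRing.isLinear.Build F {malg F[X]} V _ lin_ext lin_ext_linear.

Lemma lin_ext_gen x : lin_ext (fgen F x) = f x.
Proof. by rewrite /lin_ext /fgen msuppU oner_eq0 big_seq_fset1 mcoeffUU scale1r. Qed.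

Section Descent.
Variable R : set {malg F[X]}.
Hypothesis fR : forall r, R r -> lin_ext r = 0.

Lemma lin_ext_lspan m : lspan R m -> lin_ext m = 0.
Proof.
move=> /(_ [set m | lin_ext m = 0]); apply => //; split=> [|a x y /= x0 y0].
  exact: linear0.
by rewrite linearP /= x0 y0 scaler0 addr0.
Qed.

Definition quot_ext (q : quotient_by R) : V := lin_ext (qrepr q).

Lemma quot_extE m : quot_ext (qclass R m) = lin_ext m.
Proof.
by apply/eqP; rewrite -subr_eq0 -linearB /= lin_ext_lspan //; apply: qreprP.
Qed.

Lemma quot_ext_linear : linear quot_ext.
Proof.
move=> a x y; rewrite -[x]qreprK -[y]qreprK -qclassZ -qclassD !quot_extE.
exact: linearP.
Qed.

End Descent.
End LinearExtension.

Lemma malg_genE (F : fieldType) (X : choiceType) (m : {malg F[X]}) :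
  m = \sum_(k <- msupp m) mcoeff k m *: fgen F k.
Proof.
rewrite {1}[m]monalgE; apply: eq_bigr => k _.
by apply/malgP=> k'; rewrite mcoeffZ !mcoeffU mulrnAr mulr1.
Qed.

Lemma qclass0 (F : fieldType) (V : lmodType F) (S : set V) : qclass S 0 = 0.
Proof. by rewrite -(scale0r 0) qclassZ scale0r. Qed.

(** Presented modules carry no coordinates; facts about all their elements are
    reduced to the generators by this induction. *)
Lemma quotient_gen_ind (F : fieldType) (X : choiceType)
    (R : set {malg F[X]}) (W : set (quotient_by R)) :
  is_subspace W -> (forall x, W (qclass R (fgen F x))) -> forall q, W q.
Proof.
move=> sW WX q; rewrite -[q]qreprK; move: (qrepr q) => m.
have sW' : is_subspace [set m | W (qclass R m)].
  split=> [|a x y /= Wx Wy].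
    by rewrite /= qclass0; case: sW.
  by rewrite /= qclassD qclassZ; apply: sW.2.
rewrite [m]malg_genE.
by apply: (subspace_sum sW') => k _; apply: (subspaceZ sW').
Qed.

(** * Induced modules *)

Section GModuleTheory.
Variables (F : fieldType) (G : groupType) (V : gmodule F G).

HB.instance Definition _ g :=
  GRing.isLinear.Build F V V _ (@gact F G V g) (@gact_linear F G V g).

Lemma gactZ g a (x : V) : gact g (a *: x) = a *: gact g x.
Proof. exact: linearZ. Qed.

Lemma gactV g : cancel (@gact F G V g) (@gact F G V g^-1%g).
Proof. by move=> x; rewrite -gactM mulVg gact1. Qed.

End GModuleTheory.

Section InducedLinear.
Variables (F : fieldType) (G : groupType) (H : set G) (chi : G -> F).

Local Notation W := (fun g (x : F^o) => chi g * x : F^o).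
Local Notation ind := (induced H W).

Definition ind_gen (g : G) : ind := qclass (ind_rel H W) (fgen F (g, 1 : F^o)).

Lemma ind_genZ (g : G) (x : F^o) :
  qclass (ind_rel H W) (fgen F (g, x)) = x *: ind_gen g.
Proof.
have E0 : qclass (ind_rel H W) (fgen F (g, 0 : F^o)) = 0.
  have /qclassP : lspan (ind_rel H W) (fgen F (g, 1 *: 0 + 0 : F^o) -
    (1 *: fgen F (g, 0 : F^o) + fgen F (g, 0 : F^o))).
    by apply: lspan_sub; left; exists g, 1, 0, 0.
  rewrite !scale1r addr0 qclassD => /(congr1 (+%R^~ (- qclass (ind_rel H W)
    (fgen F (g, 0 : F^o))))).
  by rewrite subrr addrK.
have /qclassP : lspan (ind_rel H W) (fgen F (g, x *: 1 + 0 : F^o) -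
    (x *: fgen F (g, 1 : F^o) + fgen F (g, 0 : F^o))).
  by apply: lspan_sub; left; exists g, x, 1, 0.
by rewrite qclassD qclassZ E0 !addr0 => <-; congr (qclass _ (fgen F (g, _)));
  rewrite /GRing.scale /= mulr1.
Qed.

Lemma ind_act g h : gact g (ind_gen h) = ind_gen (g * h)%g.
Proof.
rewrite /ind_gen -[X in _ = qclass _ X](fmapX_gen F (ind_gen_act g) (h, 1 : F^o)).
exact: (pactE (@ind_gen_act_rel _ _ H _ W)).
Qed.

Lemma ind_genM g h : H h -> ind_gen (g * h)%g = chi h *: ind_gen g.
Proof.
move=> Hh; rewrite -ind_genZ; apply/qclassP; apply: lspan_sub; right.
by exists g, h, 1; split; [exact: Hh|rewrite mulr1].
Qed.

Lemma ind_span (S : set ind) : is_subspace S -> (forall g, S (ind_gen g)) ->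
  forall x, S x.
Proof.
move=> sS Sg; apply: quotient_gen_ind => // -[g x].
by rewrite ind_genZ; apply: subspaceZ.
Qed.

Hypothesis H1 : H 1%g.
Hypothesis HM : forall g h, H h -> H (g * h)%g <-> H g.
Hypothesis chi1 : chi 1%g = 1.
Hypothesis chiM : forall g h, H g -> H h -> chi (g * h)%g = chi g * chi h.

(** The functional is [g (x) x |-> chi g * x] on [H], and zero off [H]; it shows
    that inducing does not kill the inducing module. *)
Lemma ind_functional :
  exists phi : ind -> F, linear (phi : ind -> F^o) /\ phi (ind_gen 1%g) = 1.
Proof.
pose f (p : G * F^o) : F^o := if `[< H p.1 >] then chi p.1 * p.2 else 0.
have fR r : ind_rel H W r -> lin_ext f r = 0.
  case=> [[g [a [x [y ->]]]]|[g [h [x [Hh ->]]]]]; apply/eqP.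
    rewrite linearB linearD linearZ /= !lin_ext_gen /f /= subr_eq0.
    case: asboolP => _; last by rewrite scaler0 addr0.
    by rewrite mulrDr /GRing.scale /= mulrCA.
  rewrite linearB /= !lin_ext_gen /f /= subr_eq0; apply/eqP.
  have [Hg|nHg] := pselect (H g).
    by rewrite !asboolT ?HM // chiM // mulrA.
  by rewrite !asboolF // HM.
exists (quot_ext f (R := ind_rel H W)); split; first exact: quot_ext_linear.
by rewrite /ind_gen quot_extE // lin_ext_gen /f /= asboolT // chi1 mulr1.
Qed.

End InducedLinear.

(** * Tensor products *)

Section TensorTheory.
Variables (F : fieldType) (G : groupType) (I : finType) (V : I -> gmodule F G).

Local Notation X := {dffun forall i, V i}.
Local Notation T := (tensor V).

Definition pure (x : forall i, V i) : T :=
  qclass (tensor_rel (V := V)) (fgen F ([ffun i => x i] : X)).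

Lemma eq_pure x y : (forall i, x i = y i) -> pure x = pure y.
Proof.
move=> xy; rewrite /pure; have -> // : [ffun i => x i] = [ffun i => y i] :> X.
by apply/ffunP=> i; rewrite !ffunE.
Qed.

Definition pure_with x i (u : V i) : T := pure (dfwith x u).

Lemma pure_with_linear x i : linear (@pure_with x i).
Proof.
move=> a u v; rewrite /pure_with /pure -qclassZ -qclassD; apply/qclassP; apply: lspan_sub.
exists i, a, [ffun j => dfwith x u j], [ffun j => dfwith x v j],
  [ffun j => dfwith x (a *: u + v) j]; split; last by [].
- by rewrite !ffunE !dfwith_in.
- by move=> j ji; rewrite !ffunE !dfwith_out // eq_sym.
Qed.

HB.instance Definition _ x i :=
  GRing.isLinear.Build F (V i) T _ (@pure_with x i) (@pure_with_linear x i).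

Lemma pureZ (a : I -> F) x :
  pure (fun i => a i *: x i) = (\prod_i a i) *: pure x.
Proof.
suff H (s : seq I) : uniq s ->
    pure (fun i => if i \in s then a i *: x i else x i) =
    (\prod_(i <- s) a i) *: pure x.
  rewrite -big_enum /= -H ?enum_uniq //.
  by apply: eq_pure => i; rewrite mem_enum.
elim: s => [_|i s IH /= /andP[nis us]]; first by rewrite big_nil scale1r.
rewrite big_cons -scalerA -IH //.
pose z j := if j \in s then a j *: x j else x j.
transitivity (pure_with z (a i *: z i)).
  apply: eq_pure => j; rewrite inE; case: (dfwithP z) => [|k ik].
    by rewrite eqxx /z (negPf nis).
  by rewrite eq_sym (negPf ik).
rewrite linearZ; congr (_ *: _).
by apply: eq_pure => j; case: (dfwithP z).
Qed.

Lemma pure_act g x : gact g (pure x) = pure (fun i => gact g (x i)).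
Proof.
rewrite /pure -[in RHS](_ : tensor_gen_act g [ffun i => x i] =
  [ffun i => gact g (x i)]); last by apply/ffunP=> i; rewrite !ffunE.
rewrite -(fmapX_gen F (tensor_gen_act g)).
exact: (pactE (@tensor_gen_act_rel _ _ _ V)).
Qed.

(** By multilinearity the slots are moved into the spanning sets one at a time;
    the induction is on the number of slots lying outside. *)
Lemma tensor_span (S : forall i, set (V i)) (W : set T) :
  (forall i (U : set (V i)), is_subspace U -> S i `<=` U -> forall x, U x) ->
  is_subspace W -> (forall x, (forall i, S i (x i)) -> W (pure x)) ->
  forall t, W t.
Proof.
move=> Sspan sW WS; apply: quotient_gen_ind => // x.
suff {x} H k (x : forall i, V i) :
    (#|[pred i | ~~ `[< S i (x i) >]]| <= k)%N -> W (pure x).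
  have := H _ (fun i => x i) (leqnn _); rewrite /pure.
  have -> // : [ffun i => x i] = x; apply/ffunP=> i; exact: ffunE.
elim: k x => [|k IH] x.
  rewrite leqn0 => /eqP/card0_eq x0; apply: WS => i.
  by have := x0 i; rewrite !inE => /negbFE/asboolP.
move=> xk; have [/existsP[i ni]|/existsPn x0] :=
  boolP [exists i, ~~ `[< S i (x i) >]]; last first.
  by apply: WS => i; have := x0 i; rewrite negbK => /asboolP.
suff : forall u : V i, W (pure_with x u).
  by move=> /(_ (x i)); congr W; apply: eq_pure => j; case: (dfwithP x).
apply: (Sspan i [set u | W (pure_with x u)]).
  split=> [|a u v /= Wu Wv].
    by rewrite /= linear0; case: sW.
  by rewrite linearP; apply: sW.2.
move=> u Su /=; apply: IH; rewrite -ltnS (leq_trans _ xk) //.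
apply: proper_card; apply/properP; split.
  apply/fintype.subsetP=> j; rewrite !inE; case: (dfwithP x) => [|//].
  by rewrite (asboolT (Su : S i u)).
by exists i; rewrite !inE // dfwith_in negbK; apply/asboolP.
Qed.

Lemma pure_neq0 x (phi : forall i, V i -> F) :
  (forall i, linear (phi i : V i -> F^o)) -> (forall i, phi i (x i) != 0) ->
  pure x != 0.
Proof.
move=> phil phix.
pose f (y : X) : F^o := \prod_i phi i (y i).
have fR r : tensor_rel r -> lin_ext f r = 0.
  case=> i [a [y [z [t [ti tj ->]]]]]; apply/eqP.
  rewrite linearB linearD linearZ /= !lin_ext_gen subr_eq0; apply/eqP.
  rewrite /f [LHS](bigD1 i) // [in X in _ + X](bigD1 i) //.
  rewrite [in X in X + _](bigD1 i) //= ti phil mulrDl; congr (_ + _).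
    rewrite [RHS]scalerAl; congr (_ * _).
    by apply: eq_bigr => j /tj[->].
  by congr (_ * _); apply: eq_bigr => j /tj[_ ->].
apply/eqP; rewrite -[0](qclass0 (@tensor_rel _ _ _ V)) => /qclassP.
rewrite subr0 => /(lin_ext_lspan fR); rewrite lin_ext_gen => /eqP; apply/negP.
by apply/prodf_neq0 => i _; rewrite ffunE.
Qed.

End TensorTheory.

(** * Modules generated by an eigenvector of a normal subgroup *)

Lemma msupp_neq0 (F : fieldType) (J : choiceType) (m : {malg F[J]}) :
  m != 0 -> exists j, j \in msupp m.
Proof.
move=> m0; apply: contrapT => H; case/eqP: m0; apply/malgP => j.
rewrite mcoeff0; apply/eqP; rewrite mcoeff_eq0; apply/negP => jm.
by apply: H; exists j.
Qed.

Section Eigenvectors.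
Variables (F : fieldType) (G : groupType) (V : gmodule F G) (C : set G).

(** For [c] in [C], the operator [c - nu t0 c] kills the summand at [t0] and scales
    the summand at [t] by [nu t c - nu t0 c], which is nonzero for a suitable [c];
    this removes one summand and the induction is on their number. *)
Lemma eigen_split (T : eqType) (nu : T -> G -> F) (W : set V) (s : seq T)
    (y : T -> V) :
  is_subspace W -> (forall c x, C c -> W x -> W (gact c x)) ->
  {in s &, forall t t', t != t' -> exists2 c, C c & nu t c <> nu t' c} ->
  (forall t c, C c -> gact c (y t) = nu t c *: y t) ->
  uniq s -> W (\sum_(t <- s) y t) -> {in s, forall t, W (y t)}.
Proof.
move=> sW CW; elim: s y => [|t0 s IH] y dist yE //= /andP[nt0s us].
rewrite big_cons => Wsum.
have Ws : {in s, forall t, W (y t)}.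
  move=> t ts.
  have tt0 : t != t0 by apply: contraNneq nt0s => <-.
  have [c Cc /eqP neq] : exists2 c, C c & nu t c <> nu t0 c.
    by apply: dist; rewrite ?inE ?eqxx ?ts ?orbT.
  apply: (subspaceZ_inv sW (a := nu t c - nu t0 c)); first by rewrite subr_eq0.
  apply: (IH (fun t => (nu t c - nu t0 c) *: y t)) => //.
  - by move=> u u' us' u's; apply: dist; rewrite inE ?us' ?u's orbT.
  - by move=> u d Cd; rewrite gactZ yE // !scalerA mulrC.
  have -> : \sum_(u <- s) (nu u c - nu t0 c) *: y u =
      gact c (y t0 + \sum_(u <- s) y u) - nu t0 c *: (y t0 + \sum_(u <- s) y u).
    rewrite linearD linear_sum /= yE // scalerDr opprD addrACA subrr add0r.
    rewrite scaler_sumr -sumrB; apply: eq_bigr => u _.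
    by rewrite yE // scalerBl.
  by apply: subspaceB => //; [apply: CW|apply: subspaceZ].
move=> t; rewrite inE => /predU1P[->|/Ws//].
rewrite -(addrK (\sum_(u <- s) y u) (y t0)); apply: subspaceB => //.
by rewrite big_seq; apply: subspace_sum.
Qed.

End Eigenvectors.

Lemma isomorphic_eigenvector (F : fieldType) (G : groupType)
    (V V' : gmodule F G) (C : set G) (mu : G -> F) (e : V) :
  isomorphic V V' -> e != 0 -> (forall c, C c -> gact c e = mu c *: e) ->
  exists2 x : V', x != 0 & forall c, C c -> gact c x = mu c *: x.
Proof.
move=> [f [flin fbij fG]] e0 eC.
have f0 : f 0 = 0.
  have := flin 1 0 0; rewrite scaler0 addr0 scale1r => /(congr1 (+%R^~ (- f 0))).
  by rewrite subrr addrK.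
exists (f e) => [|c Cc].
  by apply: contra_neq e0 => fe; apply: (bij_inj fbij); rewrite f0.
by rewrite -fG eC // -[mu c *: e]addr0 flin f0 addr0.
Qed.

(** The data below make [V] the module induced from the character [mu] of the normal
    subgroup [C], recognized through its generator [e]; [ell] lists representatives
    of the cosets of [C], and the conjugates of [mu] are pairwise distinct. *)
Section Monomial.
Variables (F : fieldType) (G : groupType) (V : gmodule F G) (C : set G).
Variables (J : choiceType) (ell : J -> G) (mu : G -> F) (e : V).
Hypothesis decomp : forall g, exists j c, C c /\ g = (ell j * c)%g.
Hypothesis normC : forall g c, C c -> C (g^-1 * c * g)%g.
Hypothesis e_eigen : forall c, C c -> gact c e = mu c *: e.
Hypothesis e_span : forall W : set V, is_subspace W ->
  (forall g, W (gact g e)) -> forall x, W x.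
Hypothesis e_neq0 : e != 0.

Definition translate j := gact (ell j) e.

(** The character by which [C] acts on [translate j]. *)
Definition conj_char j c := mu ((ell j)^-1 * c * ell j)%g.

Hypothesis distinct : forall j j',
  (forall c, C c -> conj_char j c = conj_char j' c) -> j = j'.

Lemma translate_eigen j c :
  C c -> gact c (translate j) = conj_char j c *: translate j.
Proof.
move=> Cc; rewrite /translate -gactM.
have -> : (c * ell j = ell j * ((ell j)^-1 * c * ell j))%g.
  by rewrite !mulgA mulgV mul1g.
by rewrite gactM e_eigen ?gactZ //; apply: normC.
Qed.

Lemma translate_neq0 j : translate j != 0.
Proof.
apply: contraNneq e_neq0 => ej0.
by rewrite -(gactV (ell j) e) -/(translate j) ej0 linear0.
Qed.

Lemma conj_char_neq j j' : j != j' ->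
  exists2 c, C c & conj_char j c <> conj_char j' c.
Proof.
move=> jj'; apply: contrapT => H; case/eqP: jj'; apply: distinct => c Cc.
by apply: contrapT => neq; apply: H; exists c.
Qed.

Lemma translate_span W : is_subspace W -> (forall j, W (translate j)) ->
  forall x, W x.
Proof.
move=> sW We; apply: e_span => // g; have [j [c [Cc ->]]] := decomp g.
by rewrite gactM e_eigen // gactZ; apply: (subspaceZ sW _ (We j)).
Qed.

Lemma translate_sum x : exists m : {malg F[J]}, x = lin_ext translate m.
Proof.
move: x; apply: translate_span => [|j]; last first.
  by exists (fgen F j); rewrite lin_ext_gen.
split=> [|a _ _ [m ->] [m' ->]]; first by exists 0; rewrite linear0.
by exists (a *: m + m'); rewrite linearP.
Qed.

Lemma sum_split W m : is_subspace W -> (forall c x, C c -> W x -> W (gact c x)) ->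
  W (lin_ext translate m) ->
  forall j, j \in msupp m -> W (mcoeff j m *: translate j).
Proof.
move=> sW CW; apply: (eigen_split (nu := conj_char) sW CW) => //.
- by move=> j j' _ _; apply: conj_char_neq.
- by move=> j c Cc; rewrite gactZ translate_eigen // !scalerA mulrC.
Qed.

(** Any nonzero submodule contains the projection of its vectors on the
    eigenlines, and the eigenlines are permuted transitively. *)
Lemma monomial_irreducible : irreducible V.
Proof.
split=> [|W sW GW]; first by exists e.
have [[x Wx x0]|W0] := pselect (exists2 x, W x & x != 0); last first.
  left; apply/seteqP; split=> [x Wx|_ ->]; last by case: sW.
  by apply/eqP/negPn/negP => x0; apply: W0; exists x.
right; have [m xm] := translate_sum x.
have [j jm] : exists j, j \in msupp m.
  by apply: msupp_neq0; apply: contraNneq x0 => m0; rewrite xm m0 linear0.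
have We : W e.
  rewrite -(gactV (ell j) e); apply/GW/(subspaceZ_inv sW (a := mcoeff j m)).
    by rewrite mcoeff_eq0 jm.
  by apply: sum_split jm => //; [move=> c y _; apply: GW|rewrite -xm].
by apply/seteqP; split=> // y _; apply: e_span y => // g; apply: GW.
Qed.

Lemma translate_inj : injective translate.
Proof.
move=> j j' ejj'; apply: distinct => c Cc; apply/eqP; rewrite -subr_eq0.
have : (conj_char j c - conj_char j' c) *: translate j = 0.
  by rewrite scalerBl {2}ejj' -!translate_eigen // ejj' subrr.
by move/eqP; rewrite scaler_eq0 (negPf (translate_neq0 j)) orbF.
Qed.

Lemma monomial_dim : dim_eq V [set: J].
Proof.
exists (range translate); split; last first.
  by apply: inj_card_eq => j j' _ _; apply: translate_inj.
split=> [k x a xinj xT sum0 i|]; last first.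
  apply/seteqP; split=> // x _ W sW TW; apply: translate_span => // j.
  by apply: TW; exists j.
have /choice[j jE] : forall l, exists j, translate j = x l.
  by move=> l; have [j _ <-] := xT l; exists j.
have : a i *: x i = 0.
  apply: (eigen_split (C := C) (nu := fun i => conj_char (j i)) (W := [set 0])
    (y := fun i => a i *: x i) (s := index_enum 'I_k)) => //.
  - exact: subspace0.
  - by move=> c u _ /= ->; apply: linear0.
  - move=> l l' _ _ ll'; apply: conj_char_neq; apply: contra_neq ll' => jl.
    by apply: xinj; rewrite -!jE jl.
  - by move=> l c Cc; rewrite gactZ -jE translate_eigen // !scalerA mulrC.
  - exact: index_enum_uniq.
  - exact: mem_index_enum.
by move/eqP; rewrite -jE scaler_eq0 (negPf (translate_neq0 _)) orbF => /eqP.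
Qed.

(** Comparing coefficients in [c x = nu c x] on the basis of translates. *)
Lemma eigen_character (nu : G -> F) (x : V) : x != 0 ->
  (forall c, C c -> gact c x = nu c *: x) ->
  exists j, forall c, C c -> nu c = conj_char j c.
Proof.
move=> x0 xnu; have [m xm] := translate_sum x.
have [j jm] : exists j, j \in msupp m.
  by apply: msupp_neq0; apply: contraNneq x0 => m0; rewrite xm m0 linear0.
exists j => c Cc; apply/eqP; rewrite eq_sym -subr_eq0.
have : (conj_char j c - nu c) *: (mcoeff j m *: translate j) = 0.
  pose y k := (conj_char k c - nu c) *: (mcoeff k m *: translate k).
  apply: (eigen_split (C := C) (nu := conj_char) (W := [set 0]) (y := y)
    (s := msupp m)) => //.
  - exact: subspace0.
  - by move=> d u _ /= ->; apply: linear0.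
  - by move=> k k' _ _; apply: conj_char_neq.
  - move=> k d Cd; rewrite /y !gactZ translate_eigen //.
    by rewrite !scalerA; congr (_ *: _); rewrite -[in RHS]mulrA mulrC.
  transitivity (gact c x - nu c *: x); last by rewrite xnu ?subrr.
  rewrite xm /lin_ext linear_sum /= scaler_sumr -sumrB; apply: eq_bigr => k _.
  rewrite /y gactZ translate_eigen // scalerBl; congr (_ - _).
  by rewrite !scalerA mulrC.
move/eqP; rewrite !scaler_eq0 (negPf (translate_neq0 j)) orbF.
by rewrite mcoeff_eq0 jm orbF.
Qed.

End Monomial.

(** * Unitriangular matrices *)

Section Unitriangular.
Variables (A : nzRingType) (n : nat).

(** Back substitution: the rows of [Y *m Z] are corrected from the last one upward.
    A change in row [l] of [Z] affects only the rows of [Y *m Z] up to the [l]-th,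
    so the rows already corrected are kept. *)
Lemma unitriangular_rinv (Y : 'M[A]_n) :
  unitriangular Y -> exists Z, Y *m Z = 1%:M.
Proof.
move=> Yu.
suff H k : exists Z : 'M[A]_n,
    forall i j : 'I_n, (n - k <= i)%N -> (Y *m Z) i j = 1%:M i j.
  by have [Z ZE] := H n; exists Z; apply/matrixP=> i j; rewrite ZE ?subnn.
elim: k => [|k [Z ZE]].
  by exists 0 => i j; rewrite subn0 leqNgt ltn_ord.
have [nk|kn] := leqP n k.
  by exists Z => i j _; apply: ZE; move: nk; rewrite -subn_eq0 => /eqP->.
have ltn : (n - k.+1 < n)%N by rewrite ltn_subrL (leq_ltn_trans _ kn).
pose l := Ordinal ltn.
exists (Z + delta_mx l (0 : 'I_1) *m row l (1%:M - Y *m Z)) => i j.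
rewrite mulmxDr mulmxA -colE => li.
have E : (Y *m Z + col l Y *m row l (1%:M - Y *m Z)) i j =
    (Y *m Z) i j + Y i l * (1%:M - Y *m Z) l j.
  by rewrite mxE; congr (_ + _); rewrite mxE big_ord1 !mxE.
rewrite E Yu //; case: (eqVneq i l) => [->|il].
  by rewrite mul1r; move: (Y *m Z) => M; rewrite !mxE addrCA subrr addr0.
rewrite mul0r addr0; apply: ZE.
by rewrite -subnSK // ltn_neqAle li andbT eq_sym.
Qed.

(** The right inverse is again unitriangular, so it has a right inverse too, which
    must be the original matrix. *)
Lemma unitriangular_GL (Y : 'M[A]_n) :
  unitriangular Y -> exists Z : GL A n, glval Z = Y.
Proof.
move=> Yu; have [Z YZ] := unitriangular_rinv Yu.
have [T ZT] := unitriangular_rinv (unitriangular_inv YZ Yu).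
have YT : Y = T by rewrite -[Y]mulmx1 -ZT mulmxA YZ mul1mx.
suff H : mx_invertible Y by exists (MkGL H).
by apply/asboolP; exists Z; split=> //; rewrite YT.
Qed.

Definition above_diag := {p : 'I_n * 'I_n | (p.1 < p.2)%N}.

Lemma card_above_diag : #|{: above_diag}| = (n * n.-1)./2.
Proof.
rewrite card_sig -bin2 -bin2_sum big_mkord -sum1_card.
rewrite (reindex (fun p : 'I_n * 'I_n => (p.2, p.1))) /=; last first.
  by exists (fun p => (p.2, p.1)) => -[].
rewrite -(pair_big_dep xpredT (fun j i : 'I_n => (i < j)%N) (fun _ _ => 1%N)) /=.
apply: eq_bigr => j _; rewrite sum1_card.
have -> : #|[pred i : 'I_n | (i < j)%N]| = #|[set widen_ord (ltnW (ltn_ord j)) k | k : 'I_j]%SET|.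
  apply: eq_card => i; rewrite !inE; apply/idP/imsetP => [ij|[k _ ->]].
    by exists (Ordinal ij) => //; apply: val_inj.
  exact: (ltn_ord k).
by rewrite card_imset ?card_ord // => k k' /(congr1 val) /= /val_inj.
Qed.

(** A row vector lists the free entries of a unitriangular matrix; its length is the
    exponent of the degree by [card_above_diag]. *)
Definition unitri (r : 'rV[A]_#|{: above_diag}|) : 'M[A]_n :=
  \matrix_(i, j) if insub (i, j) is Some t then r 0 (enum_rank (t : above_diag))
                 else (i == j)%:R.

Lemma unitri_unitriangular r : unitriangular (unitri r).
Proof.
by move=> i j ji; rewrite mxE insubF //= ltnNge ji.
Qed.

Lemma unitri_inj : injective unitri.
Proof.
move=> r r' /matrixP rr'; apply/rowP=> k.
have := rr' (val (enum_val k)).1 (val (enum_val k)).2.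
by rewrite !mxE -surjective_pairing valK enum_valK.
Qed.

Lemma unitri_surj (Y : 'M[A]_n) : unitriangular Y -> exists r, Y = unitri r.
Proof.
move=> Yu; exists (\row_k Y (val (enum_val k)).1 (val (enum_val k)).2).
apply/matrixP=> i j; rewrite mxE; case: insubP => [t _ tE|].
  by rewrite mxE enum_rankK tE.
by rewrite -leqNgt /= => ?; apply: Yu.
Qed.

End Unitriangular.

(** * The groups C and L in block form *)

Local Notation vbasis := (@Defs.vbasis _ _).

Section BlockForm.
Variables (A : nzRingType) (star : ring_involution A).

Lemma starmx0 p q : starmx star (0 : 'M[A]_(p, q)) = 0.
Proof. by apply/matrixP=> i j; rewrite !mxE ristar0. Qed.

Lemma starmxD p q (B D : 'M[A]_(p, q)) :
  starmx star (B + D) = starmx star B + starmx star D.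
Proof. by apply/matrixP=> i j; rewrite !mxE ristarD. Qed.

Lemma starmx_block p q (a b c d : 'M[A]_(_, _)) :
  starmx star (block_mx a b c d : 'M_(p + q, p + q)) =
  block_mx (starmx star a) (starmx star c) (starmx star b) (starmx star d).
Proof.
apply/matrixP=> i j; rewrite !mxE.
by case: (split_ordP i) => k ->; case: (split_ordP j) => l ->;
  rewrite ?col_mxEu ?col_mxEd ?row_mxEl ?row_mxEr !mxE
    ?(unsplitK (inl _)) ?(unsplitK (inr _)) ?row_mxEl ?row_mxEr ?mxE.
Qed.

Lemma starmx_col p q r (a : 'M[A]_(p, r)) (b : 'M_(q, r)) :
  starmx star (col_mx a b) = row_mx (starmx star a) (starmx star b).
Proof.
apply/matrixP=> i j; rewrite !mxE.
by case: (split_ordP j) => k _; rewrite !mxE.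
Qed.

Variable n : nat.
Local Notation V := 'cV[A]_(n + n).
Local Notation h := (@hform A star n).
Local Notation "X ^*" := (starmx star X) : ring_scope.

Definition gram : 'M[A]_(n + n) := block_mx 0 1%:M (- 1%:M) 0.

Lemma hform_gram (x y : V) : h x y = (x^* *m gram *m y) 0 0.
Proof.
rewrite /hform -{3}[x]vsubmxK -{3}[y]vsubmxK starmx_col mul_row_block.
by rewrite !mulmx0 mulmxN !mulmx1 add0r addr0 mul_row_col mulNmx addrC.
Qed.

Lemma hformDl x y z : h (x + y) z = h x z + h y z.
Proof.
by rewrite !hform_gram starmxD !mulmxDl mxE.
Qed.

Lemma hformDr x y z : h x (y + z) = h x y + h x z.
Proof. by rewrite !hform_gram mulmxDr mxE. Qed.

Lemma Mspan_isotropic x y : Mspan x -> Mspan y -> h x y = 0.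
Proof.
move=> /MspanP x0 /MspanP y0; rewrite /hform x0 y0 mulmx0.
by rewrite starmx0 mul0mx subr0 mxE.
Qed.

Lemma MspanB (x y : V) : Mspan x -> Mspan y -> Mspan (x - y).
Proof.
by move=> /MspanP x0 /MspanP y0; apply/MspanP; rewrite linearB /= x0 y0 subr0.
Qed.

Lemma MspanD (x y : V) : Mspan x -> Mspan y -> Mspan (x + y).
Proof.
by move=> /MspanP x0 /MspanP y0; apply/MspanP; rewrite linearD /= x0 y0 addr0.
Qed.

Lemma UgrpP g : Ugrp star g <-> (glval g)^* *m gram *m glval g = gram.
Proof.
have E x y : h (glval g *m x) (glval g *m y) =
    (x^* *m ((glval g)^* *m gram *m glval g) *m y) 0 0.
  by rewrite hform_gram starmxM !mulmxA.
split=> [Ug|gU x y]; last by rewrite E gU -hform_gram.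
apply/matrixP=> i j; have := Ug (delta_mx i 0) (delta_mx j 0).
have entry (B : 'M[A]_(n + n)) :
    ((delta_mx i 0 : V)^* *m B *m (delta_mx j 0 : V)) 0 0 = B i j.
  have -> : (delta_mx i 0 : V)^* = delta_mx 0 i.
    apply/matrixP=> k l; rewrite !mxE andbC.
    by case: (_ && _); rewrite ?ristar1 ?ristar0.
  by rewrite -rowE -colE !mxE.
by rewrite E hform_gram !entry.
Qed.

Lemma Mspan_ubasis i : Mspan (@ubasis A n i).
Proof.
by apply/MspanP/matrixP=> k j; rewrite !mxE eq_rlshift.
Qed.

(** Fixing [M] pointwise determines the first block column; preserving the Gram
    matrix then forces the last block to be the identity and [S] to be hermitian. *)
Lemma Cgrp_block g : Cgrp star g ->
  exists S : 'M[A]_n, S^* = S /\ glval g = block_mx 1%:M S 0 1%:M.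
Proof.
move=> [/UgrpP gU gM].
have gcol i k : glval g i (lshift n k) = (i == lshift n k)%:R.
  have /matrixP/(_ i 0) := gM _ (Mspan_ubasis k).
  by rewrite /ubasis -colE !mxE andbT.
have gl : ulsubmx (glval g) = 1%:M.
  by apply/matrixP=> i j; rewrite !mxE gcol eq_lshift.
have gd : dlsubmx (glval g) = 0.
  by apply/matrixP=> i j; rewrite !mxE gcol eq_rlshift.
move: gU; rewrite -(submxK (glval g)) gl gd.
set b := ursubmx _; set d := drsubmx _.
rewrite starmx_block starmx1 /gram !mulmx_block.
rewrite starmx0 !(mul0mx, mulmx0, mul1mx, mulmx1, add0r, addr0, mulmxN, mulNmx).
move=> /eq_block_mx[_ d1 _ bb]; exists b; split; last by rewrite d1.
by move: bb; rewrite d1 starmx1 mul1mx mulmx1 addrC => /eqP; rewrite subr_eq0 => /eqP.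
Qed.

Lemma block_Cgrp (S : 'M[A]_n) : S^* = S ->
  exists g, Cgrp star g /\ glval g = block_mx 1%:M S 0 1%:M.
Proof.
move=> SS; pose c T : 'M[A]_(n + n) := block_mx 1%:M T 0 1%:M.
have cD T T' : c T *m c T' = c (T' + T).
  by rewrite mulmx_block !(mul0mx, mulmx0, mul1mx, mulmx1, add0r, addr0).
have inv : mx_invertible (c S).
  apply/asboolP; exists (c (- S)).
  by split; rewrite cD ?addNr ?subrr /c -scalar_mx_block.
exists (MkGL inv); split=> //=; split; last first.
  move=> x /MspanP x0; rewrite /= -[x]vsubmxK x0 mul_block_col.
  by rewrite mul1mx !mulmx0 mul0mx !addr0.
apply/UgrpP; rewrite /= starmx_block starmx1 SS /gram !mulmx_block.
rewrite starmx0 !(mul0mx, mulmx0, mul1mx, mulmx1, add0r, addr0, mulmxN, mulNmx).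
by rewrite addNr.
Qed.

(** The matrix [Z] here is the inverse of the one in the definition of [L]: the
    action on [N], which carries the information used below, becomes [Z^*]. *)
Lemma Lgrp_block g : Lgrp star g -> exists Z : GL A n, unitriangular (glval Z) /\
  glval g = block_mx (glval Z^-1%g) 0 0 (glval Z)^*.
Proof.
move=> [_ [Y [Yu gE]]]; exists Y^-1%g; rewrite invgK; split=> //.
exact: (unitriangular_inv (glmulV Y)).
Qed.

Lemma block_Lgrp (Y : 'M[A]_n) : unitriangular Y ->
  exists g, Lgrp star g /\ drsubmx (glval g) = Y^*.
Proof.
move=> Yu; have [Z ZY] := unitriangular_GL Yu; rewrite -{Y}ZY in Yu *.
pose l (T : GL A n) : 'M[A]_(n + n) := block_mx (glval T^-1%g) 0 0 (glval T)^*.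
have lV T : l T *m l T^-1%g = 1%:M.
  rewrite mulmx_block !(mul0mx, mulmx0, add0r, addr0) -glM mulgV -starmxM -glM.
  by rewrite mulVg !gl1 starmx1 -scalar_mx_block.
have inv : mx_invertible (l Z).
  by apply/asboolP; exists (l Z^-1%g); split; rewrite // -{2}[Z]invgK lV.
exists (MkGL inv); split; last by rewrite /= block_mxKdr.
split; last first.
  exists Z^-1%g; rewrite invgK; split=> //.
  exact: (unitriangular_inv (glmulV Z)).
apply/UgrpP; rewrite /= starmx_block starmxK /gram !mulmx_block.
rewrite starmx0 !(mul0mx, mulmx0, mul1mx, mulmx1, add0r, addr0, mulmxN, mulNmx, oppr0).
by rewrite -starmxM -glM mulgV gl1 starmx1.
Qed.

Lemma Lgrp_dr_inj (g g' : GL A (n + n)) : Lgrp star g -> Lgrp star g' ->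
  drsubmx (glval g) = drsubmx (glval g') -> g = g'.
Proof.
move=> /Lgrp_block[Z [_ gE]] /Lgrp_block[Z' [_ g'E]].
rewrite gE g'E !block_mxKdr => /(congr1 (@starmx _ star n n)).
rewrite !starmxK => /val_inj ZZ'.
by apply: val_inj; rewrite /= gE g'E ZZ'.
Qed.

Lemma Cgrp_dsubmx (c : GL A (n + n)) (x : V) : Cgrp star c -> dsubmx (glval c *m x) = dsubmx x.
Proof.
move=> /Cgrp_block[S [_ ->]].
by rewrite -{1}[x]vsubmxK mul_block_col col_mxKd mul0mx mul1mx add0r.
Qed.

Lemma Lgrp_vbasis (l : GL A (n + n)) i : Lgrp star l ->
  glval l *m vbasis i = col_mx 0 (col i (drsubmx (glval l))).
Proof.
move=> /Lgrp_block[Z [_ ->]]; rewrite block_mxKdr.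
have -> : vbasis i = col_mx 0 (delta_mx i 0) :> 'cV[A]_(n + n).
  apply/colP=> k; rewrite !mxE; case: (split_ordP k) => j ->; rewrite !mxE.
    by rewrite eq_lrshift.
  by rewrite eq_rshift.
by rewrite mul_block_col !(mul0mx, mulmx0, add0r, addr0) -colE.
Qed.

End BlockForm.

(** * The characters of C L_v *)

Section GroupP.
Variables (A : nzRingType) (star : ring_involution A) (n : nat).
Local Notation P := (Pgrp star n).
Local Notation V := 'cV[A]_(n + n).
Local Notation h := (@hform A star n).
Local Notation "X ^*" := (starmx star X) : ring_scope.

Definition LinP : set P := [set g | Lgrp star (pval g)].

Lemma pvalM (x y : P) : pval (x * y)%g = (pval x * pval y)%g.
Proof. by []. Qed.

Lemma pvalV (x : P) : pval x^-1%g = (pval x)^-1%g.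
Proof. by []. Qed.

Lemma C_in_P c : Cgrp star c -> exists g : P, pval g = c.
Proof.
move=> Cc; suff H : `[< Pset star c >] by exists (MkP H).
by apply/asboolP; exists c, 1%g; split; rewrite ?mulg1 //; apply: Lgrp1.
Qed.

Lemma L_in_P l : Lgrp star l -> exists g : P, pval g = l.
Proof.
move=> Ll; suff H : `[< Pset star l >] by exists (MkP H).
by apply/asboolP; exists 1%g, l; split; rewrite ?mul1g //; apply: Cgrp1.
Qed.

Lemma P_decomp (g : P) : exists c l : P, [/\ CinP star n c, LinP l & g = (c * l)%g].
Proof.
have /asboolP[c [l [Cc Ll gE]]] := pvalP g.
have [c' c'E] := C_in_P Cc; have [l' l'E] := L_in_P Ll.
exists c', l'; split; rewrite /CinP /LinP /= ?c'E ?l'E //.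
by apply: val_inj; rewrite [LHS]gE -c'E -l'E.
Qed.

Lemma CinP_normal (g c : P) : CinP star n c -> CinP star n (g * c * g^-1)%g.
Proof.
have [d [l [Cd Ll ->]]] := P_decomp g => Cc.
have -> : (d * l * c * (d * l)^-1 = d * (l * c * l^-1) * d^-1)%g.
  by rewrite invgM !mulgA.
by apply: CgrpM (CgrpV Cd); apply: (CgrpM Cd); apply: CgrpJ.
Qed.

Lemma CinP_conj (g c : P) : CinP star n c -> CinP star n (g^-1 * c * g)%g.
Proof. by move=> Cc; have := CinP_normal g^-1%g Cc; rewrite invgK. Qed.

Lemma P_decompr (g : P) : exists l c : P, [/\ LinP l, CinP star n c & g = (l * c)%g].
Proof.
have [c [l [Cc Ll ->]]] := P_decomp g.
exists l, (l^-1 * c * l)%g; split => //; first exact: CinP_conj.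
by rewrite !mulgA mulgV mul1g.
Qed.

Lemma CinP_abelian (x y : P) : CinP star n x -> CinP star n y -> (x * y = y * x)%g.
Proof.
move=> /Cgrp_block[S [_ xE]] /Cgrp_block[T [_ yE]].
apply/val_inj/val_inj; rewrite [LHS]glM [RHS]glM xE yE !mulmx_block.
by rewrite !(mul0mx, mulmx0, mul1mx, mulmx1, add0r, addr0) addrC.
Qed.

Lemma CinP_normal_abelian : normal_abelian_subgroup (CinP star n).
Proof.
split; first exact: Cgrp1.
- by move=> x y Cx Cy; apply: (CgrpM Cx); apply: CgrpV.
- exact: CinP_normal.
- exact: CinP_abelian.
Qed.

Lemma P_Ugrp (g : P) : Ugrp star (pval g).
Proof. by have [c [l [[Uc _] [Ul _] ->]]] := P_decomp g; apply: UgrpM. Qed.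

Lemma P_Mspan (g : P) (x : V) : Mspan x -> Mspan (glval (pval g) *m x).
Proof.
have [c [l [[_ Mc] Ll ->]]] := P_decomp g => Mx.
by have Ml := Lgrp_Mspan Ll Mx; rewrite glM -mulmxA (Mc _ Ml).
Qed.

(** In this form, membership in [C L_v] is visibly stable under products, as [P]
    preserves [M]. *)
Lemma CLstabP i (g : P) :
  CLstab (vbasis i) g <-> Mspan (glval (pval g) *m vbasis i - vbasis i).
Proof.
split=> [[c [l [Cc [_ lv] gE]]]|].
  rewrite gE glM -mulmxA lv; apply/MspanP.
  by rewrite linearB /= (Cgrp_dsubmx _ Cc) subrr.
have [c [l [Cc Ll ->]]] := P_decomp g => /MspanP.
rewrite pvalM glM -mulmxA linearB /= (Cgrp_dsubmx _ Cc) => /eqP.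
rewrite subr_eq0 => /eqP lv; exists (pval c), (pval l); split=> //; split=> //.
rewrite -[LHS]vsubmxK lv -[RHS]vsubmxK; congr col_mx.
rewrite (Lgrp_vbasis _ Ll) col_mxKu.
by apply/colP=> k; rewrite !mxE eq_lrshift.
Qed.

Lemma CLstab1 i : CLstab (vbasis i) (1%g : P).
Proof. by apply/CLstabP/MspanP; rewrite gl1 mul1mx subrr linear0. Qed.

Lemma C_CLstab i c : CinP star n c -> CLstab (vbasis i) c.
Proof.
by move=> Cc; apply/CLstabP/MspanP; rewrite linearB /= (Cgrp_dsubmx _ Cc) subrr.
Qed.

Lemma CLstabM i (g k : P) : CLstab (vbasis i) k ->
  CLstab (vbasis i) (g * k)%g <-> CLstab (vbasis i) g.
Proof.
move=> /CLstabP/(P_Mspan g) Mk; rewrite !CLstabP.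
have -> : glval (pval (g * k)%g) *m vbasis i - vbasis i =
    glval (pval g) *m (glval (pval k) *m vbasis i - vbasis i) +
    (glval (pval g) *m vbasis i - vbasis i).
  by rewrite mulmxBr pvalM glM mulmxA addrA subrK.
split=> Mg; last exact: MspanD.
by have := MspanB Mg Mk; rewrite addrC addKr.
Qed.

(** The argument [h (g v, v)] is additive on the stabilizer of [v] modulo [M],
    because [M] is isotropic and stable under the isometries in [P]. *)
Lemma hform_CLstabM i (g k : P) :
  CLstab (vbasis i) g -> CLstab (vbasis i) k ->
  h (glval (pval (g * k)%g) *m vbasis i) (vbasis i) =
  h (glval (pval g) *m vbasis i) (vbasis i) +
  h (glval (pval k) *m vbasis i) (vbasis i).
Proof.
move=> /CLstabP; set v := vbasis i; set gv := glval (pval g) *m v => Mg.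
move=> /CLstabP; rewrite -/v => Mm.
have [m {}Mm kvE] : exists2 m, Mspan m & glval (pval k) *m v = v + m.
  by exists (glval (pval k) *m v - v); rewrite // addrC subrK.
rewrite pvalM glM -mulmxA kvE mulmxDr !hformDl -/gv; congr (_ + _).
rewrite hform_vv add0r -(P_Ugrp g m v) -/gv -[in RHS](addrNK v gv) addrC.
by rewrite hformDr (Mspan_isotropic _ (P_Mspan g Mm) Mg) addr0.
Qed.

Section Character.
Variables (F : fieldType) (lam : A -> F).
Hypothesis lamP : linear_character lam.

Lemma linear_character0 : lam 0 = 1.
Proof.
have [l0 lD] := lamP; apply: (mulfI (l0 0)).
by rewrite -lD addr0 mulr1.
Qed.

Lemma chi1 i : chi lam (vbasis i) (1%g : P) = 1.
Proof. by rewrite /chi gl1 mul1mx hform_vv linear_character0. Qed.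

Lemma chiM i (g k : P) : CLstab (vbasis i) g -> CLstab (vbasis i) k ->
  chi lam (vbasis i) (g * k)%g = chi lam (vbasis i) g * chi lam (vbasis i) k.
Proof. by move=> Hg Hk; rewrite /chi hform_CLstabM // lamP.2. Qed.

(** As [l] is an isometry, the argument of [lam] is [h (c (l v), l v)]: the hermitian
    form of matrix [S] evaluated at the vector [l v], which is the [i]-th column
    of [X]. *)
Lemma chi_conj i (l c : P) (S : 'M[A]_n) (X := drsubmx (glval (pval l))) :
  LinP l -> S^* = S -> glval (pval c) = block_mx 1%:M S 0 1%:M ->
  chi lam (vbasis i) (l^-1 * c * l)%g = lam ((X^* *m S *m X) i i).
Proof.
move=> Ll SS cE; rewrite /chi; congr lam.
rewrite -(P_Ugrp l) !pvalM pvalV !glM !mulmxA glmulV mul1mx -mulmxA.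
rewrite (Lgrp_vbasis _ Ll) cE mul_block_col !(mul0mx, mulmx0, mul1mx, add0r).
rewrite /hform !col_mxKu !col_mxKd mulmx0 subr0 starmxM SS -/X.
have -> : (col i X)^* = row i X^* by apply/rowP=> k; rewrite !mxE.
rewrite -row_mul; move: (X^* *m S) => B.
by rewrite !mxE; apply: eq_bigr => k _; rewrite [row _ _ _ _]mxE [col _ _ _ _]mxE.
Qed.

End Character.

(** Modulo [M], the image of [v_i] under [g i] is the [i]-th column of a lower
    unitriangular matrix.  Columns taken from different such matrices still
    assemble into one, which is the action on [N] of a single element of [L]. *)
Lemma common_translate (g : 'I_n -> P) :
  exists l : P, forall i, CLstab (vbasis i) (l^-1 * g i)%g.
Proof.
pose Y : 'M[A]_n := \matrix_(i, j) star (drsubmx (glval (pval (g i))) j i).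
have drE i : exists Z : 'M[A]_n, unitriangular Z /\
    drsubmx (glval (pval (g i))) = Z^*.
  have [c [l [/Cgrp_block[S [_ cE]] /Lgrp_block[Z [Zu lE]] ->]]] := P_decomp (g i).
  exists (glval Z); split=> //.
  by rewrite pvalM glM cE lE mulmx_block block_mxKdr mul0mx mul1mx add0r.
have Yu : unitriangular Y.
  move=> i j ji; rewrite mxE; have [Z [Zu ->]] := drE i.
  by rewrite mxE ristarK Zu.
have [l [Ll lE]] := block_Lgrp star Yu; have [l' l'E] := L_in_P Ll.
exists l' => i; apply/CLstabP.
have -> : glval (pval (l'^-1 * g i)%g) *m vbasis i - vbasis i =
    glval (pval l'^-1%g) *m (glval (pval (g i)) *m vbasis i -
      glval (pval l') *m vbasis i).
  by rewrite mulmxBr !mulmxA -!glM -!pvalM mulVg gl1 mul1mx.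
apply: P_Mspan; apply/MspanP; rewrite linearB /= l'E (Lgrp_vbasis _ Ll) col_mxKd.
apply/eqP; rewrite subr_eq0 lE; apply/eqP/colP=> k.
by rewrite -colE !mxE ristarK.
Qed.

Lemma LinP_inj (l l' : P) : LinP l -> LinP l' ->
  drsubmx (glval (pval l)) = drsubmx (glval (pval l')) -> l = l'.
Proof. by move=> Ll Ll' E; apply/val_inj/(Lgrp_dr_inj Ll Ll' E). Qed.

End GroupP.

(** * Admissible characters separate the conjugates *)

Section Separation.
Variables (A : nzRingType) (star : ring_involution A) (n : nat).
Local Notation P := (Pgrp star n).
Local Notation "X ^*" := (starmx star X) : ring_scope.

(** The matrix with [a] at [(j, k)] as its only nonzero entry, factored through a
    column and a row because scalars of [A] do not commute with matrices. *)
Definition entry_mx (j k : 'I_n) (a : A) : 'M[A]_n :=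
  delta_mx j (0 : 'I_1) *m a%:M *m delta_mx (0 : 'I_1) k.

Lemma entry_mxE j k a p q :
  entry_mx j k a p q = if (p == j) && (q == k) then a else 0.
Proof.
rewrite mxE big_ord1 mxE big_ord1 !mxE !eqxx andbT mulr1n.
by case: (p == j); case: (q == k); rewrite ?mul1r ?mulr1 ?mul0r ?mulr0.
Qed.

Lemma quad_entry (X : 'M[A]_n) j k a i :
  (X^* *m entry_mx j k a *m X) i i = star (X j i) * a * X k i.
Proof.
rewrite !mulmxA -colE -mulmxA -rowE mxE big_ord1 [row _ _ _ _]mxE; congr (_ * _).
by rewrite mxE big_ord1 !mxE mulr1n.
Qed.

Definition herm_mx j k a := entry_mx j k a + (entry_mx j k a)^*.

Lemma herm_mx_star j k a : (herm_mx j k a)^* = herm_mx j k a.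
Proof. by rewrite starmxD starmxK addrC. Qed.

Lemma quad_herm (X : 'M[A]_n) j k a i :
  (X^* *m herm_mx j k a *m X) i i =
  star (X j i) * a * X k i + star (star (X j i) * a * X k i).
Proof.
rewrite mulmxDr mulmxDl mxE quad_entry -quad_entry; congr (_ + _).
move: (entry_mx j k a) => E.
have -> : X^* *m E^* *m X = (X^* *m E *m X)^* by rewrite !starmxM starmxK mulmxA.
by rewrite mxE.
Qed.

Variable F : fieldType.

Lemma left_admissible_eq0 (lam : A -> F) x : left_admissible star lam ->
  (forall a, lam (a * x + star (a * x)) = 1) -> x = 0.
Proof.
move=> [_ adm] lam1.
have ideal : left_ideal [set b | exists a, b = a * x].
  split=> [|_ _ [a ->] [b ->]|a _ [b ->]]; first by exists 0; rewrite mul0r.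
    by exists (a - b); rewrite mulrBl.
  by exists (a * b); rewrite mulrA.
have : [set b | exists a, b = a * x] x by exists 1; rewrite mul1r.
by rewrite (adm _ ideal) // => _ [a ->].
Qed.

(** The columns of [X] are treated from left to right.  If the columns before the
    [k]-th are those of the identity, the form supported at the entries [(j, k)]
    and [(k, j)] contributes to the [k]-th factor only, where it sweeps a left
    ideal generated by the entry [(j, k)] of [X]. *)
Lemma separation (lam : 'I_n -> A -> F) (Z : 'M[A]_n) (X := Z^*) :
  unitriangular Z -> (forall i, left_admissible star (lam i)) ->
  (forall S, S^* = S -> (forall i, S i i = 0) ->
     \prod_i lam i ((X^* *m S *m X) i i) = 1) ->
  X = 1%:M.
Proof.
move=> Zu adm lam1.
have Xd k : X k k = 1 by rewrite mxE Zu // eqxx ristar1.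
have Xlow (j k : 'I_n) : (j < k)%N -> X j k = 0.
  move=> jk; rewrite mxE Zu; last exact: ltnW.
  by rewrite -val_eqE (gtn_eqF jk) mulr0n ristar0.
suff H m (k j : 'I_n) : (k < m)%N -> j != k -> X j k = 0.
  apply/matrixP=> j k; rewrite [RHS]mxE; case: (eqVneq j k) => [->|jk]; first by rewrite Xd.
  by rewrite (H n).
elim: m k j => // m IH k j km jk.
(* With [star a] at the entry [(j, k)], the term left over is the sum
   [a * X j k + star (a * X j k)]. *)
apply: (left_admissible_eq0 (adm k)) => a.
have S0 i : herm_mx j k (star a) i i = 0.
  rewrite mxE entry_mxE mxE entry_mxE; case: eqP => [->|_]; last first.
    by rewrite ristar0 addr0.
  by rewrite (negPf jk) ristar0 addr0.
have := lam1 _ (herm_mx_star j k (star a)) S0.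
rewrite (bigD1 k) //= big1 => [|i ik]; rewrite quad_herm.
  by rewrite mulr1 Xd mulr1 -ristarM ristarK addrC.
suff -> : X k i = 0 by rewrite mulr0 ristar0 addr0 (linear_character0 (adm i).1).
have [ki|ik'] := ltnP k i; first exact: Xlow.
apply: IH; last by rewrite eq_sym.
by rewrite -ltnS (leq_trans _ km) // ltnS ltn_neqAle ik' andbT.
Qed.

(** On [C] this is the character by which [C] acts on the generator of the module. *)
Definition mu (lam : 'I_n -> A -> F) (g : P) := \prod_i chi (lam i) (vbasis i) g.

Lemma mu_conj lam (l c : P) (S : 'M[A]_n) (X := drsubmx (glval (pval l))) :
  LinP l -> S^* = S -> glval (pval c) = block_mx 1%:M S 0 1%:M ->
  mu lam (l^-1 * c * l)%g = \prod_i lam i ((X^* *m S *m X) i i).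
Proof.
by move=> Ll SS cE; apply: eq_bigr => i _; apply: chi_conj.
Qed.

Lemma LinP1 : LinP (1%g : P).
Proof. exact: Lgrp1. Qed.

Lemma mu_block lam (c : P) (S : 'M[A]_n) : S^* = S ->
  glval (pval c) = block_mx 1%:M S 0 1%:M -> mu lam c = \prod_i lam i (S i i).
Proof.
move=> SS cE; have := mu_conj lam LinP1 SS cE.
rewrite invg1 mulg1 mul1g => ->; rewrite gl1 scalar_mx_block block_mxKdr.
by rewrite starmx1 mul1mx mulmx1.
Qed.

(** Hermitian matrices with zero diagonal have trivial [mu], so [separation] applies
    and forces [l = 1]; a diagonal matrix with one nonzero entry then compares a
    single pair of characters. *)
Lemma mu_separation lam lam' (l : P) :
  (forall i, left_admissible star (lam i)) ->
  (forall i, left_admissible star (lam' i)) -> LinP l ->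
  (forall c, CinP star n c -> mu lam c = mu lam' (l^-1 * c * l)%g) ->
  l = 1%g /\ forall i r, star r = r -> lam i r = lam' i r.
Proof.
move=> adm adm' Ll eqmu.
have lam0 i : lam i 0 = 1 := linear_character0 (adm i).1.
have lam'0 i : lam' i 0 = 1 := linear_character0 (adm' i).1.
have cOf (S : 'M[A]_n) : S^* = S -> exists2 c : P, CinP star n c &
    glval (pval c) = block_mx 1%:M S 0 1%:M.
  move=> /block_Cgrp[g [Cg gE]]; have [c cE] := C_in_P Cg.
  by exists c; rewrite /CinP /= cE.
have [Z [Zu lE]] := Lgrp_block Ll.
have dr1 : drsubmx (glval (pval l)) = 1%:M.
  rewrite lE block_mxKdr; apply: (separation Zu adm') => S SS S0.
  have [c Cc cE] := cOf S SS; have := eqmu c Cc.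
  rewrite (mu_block _ SS cE) (mu_conj _ Ll SS cE) lE block_mxKdr => <-.
  by rewrite big1 // => i _; rewrite S0.
have l1 : l = 1%g.
  by apply: (LinP_inj Ll LinP1); rewrite dr1 gl1 scalar_mx_block block_mxKdr.
split=> // i r rr.
have SS : (entry_mx i i r)^* = entry_mx i i r.
  apply/matrixP=> p q; rewrite mxE !entry_mxE andbC.
  by case: (_ && _); rewrite ?rr ?ristar0.
have [c Cc cE] := cOf _ SS; have := eqmu c Cc.
rewrite l1 invg1 mulg1 mul1g !(mu_block _ SS cE).
rewrite (bigD1 i) // [in RHS](bigD1 i) //= entry_mxE !eqxx /=.
by rewrite !big1 ?mulr1 // => k /negPf ki; rewrite entry_mxE ki.
Qed.

End Separation.

(** * The modules V(D, lam) *)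

Section ModuleVD.
Variables (A : nzRingType) (star : ring_involution A) (n : nat) (F : fieldType).
Variables (D : {set 'I_n}) (lam : 'I_n -> A -> F).
Hypothesis lamP : forall i, linear_character (lam i).
Local Notation P := (Pgrp star n).
Local Notation T := (VD star D lam).
Local Notation I := {i : 'I_n | i \in D}.

Definition Vi_gen (i : I) (g : P) : Vi star (lam (val i)) (val i) :=
  ind_gen (CLstab (vbasis (val i))) (chi (lam (val i)) (vbasis (val i))) g.

Lemma Vi_gen_act i g k : gact g (Vi_gen i k) = Vi_gen i (g * k)%g.
Proof. exact: ind_act. Qed.

Definition VD_gen : T := pure (fun i : I => Vi_gen i 1%g).

Lemma VD_gen_eigen (c : P) : CinP star n c ->
  gact c VD_gen = (\prod_(i : I) chi (lam (val i)) (vbasis (val i)) c) *: VD_gen.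
Proof.
move=> Cc; rewrite [LHS]pure_act -pureZ; apply: eq_pure => i.
rewrite Vi_gen_act mulg1 -[c in LHS]mul1g.
by apply: ind_genM; apply: C_CLstab.
Qed.

(** The generators [x i] of the factors differ by scalars from the translates of
    [1 (x) 1] by one common [l], so their tensor is a multiple of a translate of
    the generator. *)
Lemma VD_gen_span (W : set T) : is_subspace W ->
  (forall g, W (gact g VD_gen)) -> forall x, W x.
Proof.
move=> sW gW; apply: (tensor_span (S := fun i => range (Vi_gen i))) => //.
  by move=> i U sU SU; apply: ind_span => // g; apply: SU; exists g.
move=> x xS.
have /choice[g gE] : forall i : I, exists g, Vi_gen i g = x i.
  by move=> i; have [g _ <-] := xS i; exists g.
pose g' (i : 'I_n) : P := if insub i is Some j then g j else 1%g.
have [l lP] := common_translate g'.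
have -> : pure x =
    pure (fun i => chi (lam (val i)) (vbasis (val i)) (l^-1 * g i)%g *: Vi_gen i l).
  apply: eq_pure => i; rewrite -gE -[X in Vi_gen i X](mulVKg l).
  by apply: ind_genM; have := lP (val i); rewrite /g' valK.
rewrite pureZ; apply: (subspaceZ sW).
have -> : pure (fun i => Vi_gen i l) = gact l VD_gen.
  rewrite [RHS]pure_act; apply: eq_pure => i.
  exact: esym (etrans (Vi_gen_act i l 1%g) (congr1 (Vi_gen i) (mulg1 l))).
exact: gW.
Qed.

(** The product of the functionals of [ind_functional] takes the value 1 here. *)
Lemma VD_gen_neq0 : VD_gen != 0.
Proof.
have ex_phi (i : I) : exists phi : Vi star (lam (val i)) (val i) -> F,
    linear (phi : _ -> F^o) /\ phi (Vi_gen i 1%g) = 1.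
  apply: ind_functional.
  - exact: CLstab1.
  - exact: CLstabM.
  - exact: chi1.
  - exact: chiM.
pose phi i := projT1 (cid (ex_phi i)).
apply: (pure_neq0 (phi := phi)) => i; have [linphi phi1] := projT2 (cid (ex_phi i)).
  exact: linphi.
by rewrite /phi phi1 oner_neq0.
Qed.

End ModuleVD.

(** * Irreducibility, degree and isomorphism of V(D, lam) *)

Section Parametrization.
Variables (A : nzRingType) (star : ring_involution A) (n : nat).
Local Notation P := (Pgrp star n).
Local Notation J := 'rV[A]_#|{: above_diag n}|.

Fact ell_exists (r : J) : exists g : P,
  LinP g /\ drsubmx (glval (pval g)) = starmx star (unitri r).
Proof.
have [l [Ll lE]] := block_Lgrp star (unitri_unitriangular r).
by have [g gE] := L_in_P Ll; exists g; rewrite /LinP /= gE.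
Qed.

(** The elements of [L], indexed by row vectors over [A]: the index type of the basis
    of translates is then the one that expresses the degree. *)
Definition ell (r : J) : P := projT1 (cid (ell_exists r)).

Lemma ellP r : LinP (ell r) /\ drsubmx (glval (pval (ell r))) = starmx star (unitri r).
Proof. by rewrite /ell; case: cid. Qed.

Lemma ell_inj : injective ell.
Proof.
move=> r r' E; apply: unitri_inj.
rewrite -[LHS](starmxK star) -[RHS](starmxK star); congr (starmx star _).
by rewrite -(ellP r).2 -(ellP r').2 E.
Qed.

Lemma ell_surj (l : P) : LinP l -> exists r, l = ell r.
Proof.
move=> Ll; have [Z [Zu lE]] := Lgrp_block Ll; have [r rE] := unitri_surj Zu.
exists r; apply: LinP_inj => //; first by case: (ellP r).
by rewrite (ellP r).2 lE block_mxKdr rE.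
Qed.

Lemma ell_decomp (g : P) : exists r c, CinP star n c /\ g = (ell r * c)%g.
Proof.
have [l [c [Ll Cc ->]]] := P_decompr g; have [r ->] := ell_surj Ll.
by exists r, c.
Qed.

Lemma ellVM r r' : LinP ((ell r)^-1 * ell r')%g.
Proof.
have [Lr _] := ellP r; have [Lr' _] := ellP r'.
by apply: LgrpM Lr'; apply: LgrpV.
Qed.

Lemma card_lcosets_C : lcosets (CinP star n) #= [set: J].
Proof.
pose f r := [set (ell r * x)%g | x in CinP star n].
have -> : lcosets (CinP star n) = range f.
  apply/seteqP; split=> [_ [g ->]|_ [r _ <-]]; last by exists (ell r).
  have [r [c [Cc ->]]] := ell_decomp g; exists r => //.
  apply/seteqP; split=> [_ [x Cx <-]|_ [x Cx <-]].
    exists (c^-1 * x)%g; last by rewrite -mulgA mulVKg.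
    exact: CgrpM (CgrpV Cc) Cx.
  by exists (c * x)%g; rewrite ?mulgA //; apply: CgrpM Cc Cx.
apply: inj_card_eq => r r' _ _ frr'.
have : f r' (ell r) by rewrite -frr'; exists 1%g; [apply: Cgrp1|rewrite mulg1].
move=> [c /Cgrp_block[S [_ cE]] rE]; apply: ell_inj.
apply: LinP_inj; [exact: (ellP r).1|exact: (ellP r').1|].
have [Z [_ r'E]] := Lgrp_block (ellP r').1.
rewrite -rE pvalM glM r'E cE mulmx_block !block_mxKdr.
by rewrite mul0mx mulmx1 add0r.
Qed.

Variable F : fieldType.

Lemma VD_distinct (lam : 'I_n -> A -> F) :
  (forall i, left_admissible star (lam i)) ->
  forall r r', (forall c, CinP star n c ->
    conj_char ell (mu lam) r c = conj_char ell (mu lam) r' c) -> r = r'.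
Proof.
move=> adm r r' eqc; have := mu_separation adm adm (ellVM r r').
case=> [c Cc|rr' _].
  have := eqc (ell r * c * (ell r)^-1)%g (CinP_normal _ Cc).
  rewrite /conj_char !mulgA mulVg mul1g mulgVK => ->; congr (mu lam _).
  by rewrite invgM invgK.
apply/esym; apply: ell_inj; rewrite -[ell r'](mulVKg (ell r)) rr'; apply: mulg1.
Qed.

Section Full.
Variable lam : 'I_n -> A -> F.
Hypothesis adm : forall i, left_admissible star (lam i).
Local Notation Vfull := (VD star [set: 'I_n]%SET lam).

Lemma prod_full (f : 'I_n -> F) :
  \prod_(i : {i | i \in [set: 'I_n]%SET}) f (val i) = \prod_i f i.
Proof.
rewrite [RHS](reindex (fun i : {i | i \in [set: 'I_n]%SET} => val i)) //.
by exists (fun i => exist _ i (finset.in_setT i)) => i _; first exact: val_inj.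
Qed.

Lemma VD_full_generator : exists e : Vfull, [/\ e != 0,
  forall c, CinP star n c -> gact c e = mu lam c *: e &
  forall W : set Vfull, is_subspace W -> (forall g, W (gact g e)) -> forall x, W x].
Proof.
have lin i : linear_character (lam i) by case: (adm i).
exists (VD_gen star [set: 'I_n]%SET lam); split.
- exact: VD_gen_neq0.
- move=> c Cc; rewrite /mu -prod_full; exact: VD_gen_eigen.
- exact: VD_gen_span.
Qed.

Lemma VD_full_irreducible : irreducible Vfull.
Proof.
have [e [e0 eC espan]] := VD_full_generator.
exact: (monomial_irreducible ell_decomp (@CinP_conj _ _ _) eC espan e0
  (VD_distinct adm)).
Qed.

Lemma VD_full_dim : dim_eq Vfull [set: J].
Proof.
have [e [e0 eC espan]] := VD_full_generator.
exact: (monomial_dim ell_decomp (@CinP_conj _ _ _) eC espan e0 (VD_distinct adm)).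
Qed.

End Full.

Lemma VD_full_isomorphic (lam lam' : 'I_n -> A -> F) :
  (forall i, left_admissible star (lam i)) ->
  (forall i, left_admissible star (lam' i)) ->
  isomorphic (VD star [set: 'I_n]%SET lam) (VD star [set: 'I_n]%SET lam') ->
  forall i r, star r = r -> lam i r = lam' i r.
Proof.
move=> adm adm' iso.
have [e [e0 eC _]] := VD_full_generator adm.
have [e' [e'0 e'C e'span]] := VD_full_generator adm'.
have [x x0 xC] := isomorphic_eigenvector iso e0 eC.
have [r rP] := eigen_character ell_decomp (@CinP_conj _ _ _) e'C e'span e'0
  (VD_distinct adm') x0 xC.
by have [] := mu_separation adm adm' (ellP r).1 rP.
Qed.

End Parametrization.

(** * Bases inside finite spanning sets *)

Section Bases.
Variables (F : fieldType) (V : lmodType F).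

(** In a relation that involves [x], the coefficient of [x] vanishes since [x] is
    outside the span; what remains is a relation in [B]. *)
Lemma lin_indepU1 (B : set V) x :
  lin_indep B -> ~ lspan B x -> lin_indep (x |` B).
Proof.
move=> Bind Bx k y c yinj yB sum0.
have in_B i : y i <> x -> B (y i) by move=> yx; case: (yB i) => // /yx.
have [[i0 yi0]|nx] := pselect (exists i, y i = x); last first.
  by apply: (Bind k y c yinj) => // i; apply: in_B => yx; apply: nx; exists i.
case: k i0 y c yinj yB sum0 in_B yi0 => [[] //|k] i0 y c yinj yB sum0 in_B yi0.
have yB' j : B (y (lift i0 j)).
  by apply: in_B; rewrite -yi0 => /yinj /eqP; rewrite eq_sym (negPf (neq_lift _ _)).
move: sum0; rewrite (bigD1_ord i0) //= => sum0.
have ci0 : c i0 = 0.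
  apply: contrapT => /eqP c0; apply: Bx; rewrite -yi0.
  apply: (subspaceZ_inv (lspan_subspace B) c0).
  move/eqP: sum0; rewrite addr_eq0 => /eqP ->; rewrite -scaleN1r.
  apply: (subspaceZ (lspan_subspace B)).
  apply: (subspace_sum (lspan_subspace B)) => j _.
  by apply: (subspaceZ (lspan_subspace B)); apply: lspan_sub.
move: sum0; rewrite ci0 scale0r add0r => sum0 i.
case: (unliftP i0 i) => [l ->|-> //].
apply: (Bind k (fun j => y (lift i0 j)) (fun j => c (lift i0 j))) => //.
by move=> j j' /yinj /lift_inj.
Qed.

Lemma lspan_le (S T : set V) : S `<=` lspan T -> lspan S `<=` lspan T.
Proof. by move=> ST x; apply => //; apply: lspan_subspace. Qed.

Lemma sub_basis (s : seq V) : exists B : set V,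
  [/\ B `<=` [set` s], lin_indep B & [set` s] `<=` lspan B].
Proof.
elim: s => [|x s [B [Bs Bind sB]]].
  exists set0; split=> //.
  by move=> [|k] y c _ y0 _ [i ilt] //; case: (y0 ord0).
have [Bx|nBx] := pselect (lspan B x).
  exists B; split=> //; first by move=> y /Bs /= ys; rewrite inE ys orbT.
  by move=> y /=; rewrite inE => /predU1P[->|/sB].
exists (x |` B); split; last 2 first.
- exact: lin_indepU1.
- move=> y /=; rewrite inE => /predU1P[->|/sB].
    by apply: lspan_sub; left.
  by apply: lspan_le => z Bz; apply: lspan_sub; right.
move=> y [->|/Bs] /=; first by rewrite mem_head.
by rewrite inE => ->; rewrite orbT.
Qed.

Lemma dim_le_range (T : choiceType) (f : T -> V) :
  finite_set (range f) -> lspan (range f) = setT -> dim_le V [set: T].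
Proof.
move=> /finite_seqP[s sE] fT; have [B [Bs Bind sB]] := sub_basis s.
exists B; split.
  split=> //; apply/seteqP; split=> // x _.
  by apply: (lspan_le sB); rewrite -sE fT.
apply: card_le_trans (card_image_le f setT); apply: subset_card_le.
by rewrite sE.
Qed.

End Bases.

Lemma inj_card_le (T U : Type) (f : T -> U) (X : set T) :
  injective f -> X #<= f @` X.
Proof.
move=> finj; have : f @` X #= X by apply: inj_card_eq => x y _ _; apply: finj.
by rewrite card_eq_le => /andP[].
Qed.

(** * Common eigenvectors and the bound on the degree *)

Section Eigenvector.
Variables (F : closedFieldType) (V : lmodType F) (T : {linear V -> V}) (x : V).

(** This is [p (T) x]; the space has arbitrary dimension, so no matrix is used. *)
Definition poly_act (p : {poly F}) : V :=
  \sum_(i < size p) p`_i *: iter i T x.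

Lemma poly_actw (p : {poly F}) m : (size p <= m)%N ->
  poly_act p = \sum_(i < m) p`_i *: iter i T x.
Proof.
move=> pm; rewrite /poly_act (big_ord_widen_cond m xpredT
  (fun i => p`_i *: iter i T x)) // big_mkcond /=.
apply: eq_bigr => i _; case: ltnP => // /leq_sizeP/(_ i (leqnn _)) ->.
by rewrite scale0r.
Qed.

Lemma poly_act_subXc (q : {poly F}) z :
  poly_act (q * ('X - z%:P)) = T (poly_act q) - z *: poly_act q.
Proof.
have sz : (size (q * ('X - z%:P))%R <= (size q).+1)%N.
  by apply: leq_trans (size_polyMleq q _) _; rewrite size_XsubC addn2.
rewrite (poly_actw sz) mulrBr.
have -> : \sum_(i < (size q).+1) (q * 'X - q * z%:P)`_i *: iter i T x =
  \sum_(i < (size q).+1) (q * 'X)`_i *: iter i T x -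
  \sum_(i < (size q).+1) z *: (q`_i *: iter i T x).
  rewrite -sumrB; apply: eq_bigr => i _.
  by rewrite coefB coefMC scalerBl scalerA [q`_i * z]mulrC.
rewrite -scaler_sumr -(poly_actw (leqnSn (size q))) big_ord_recl coefMX scale0r add0r.
congr (_ - _); rewrite linear_sum; apply: eq_bigr => i _ /=.
by rewrite coefMX linearZ.
Qed.

(** A nonzero polynomial annihilating [x] is divided by its linear factors one at
    a time, until the quotient no longer annihilates [x]. *)
Lemma poly_act_eigen (p : {poly F}) : x != 0 -> p != 0 -> poly_act p = 0 ->
  exists q z, poly_act q != 0 /\ T (poly_act q) = z *: poly_act q.
Proof.
move=> x0; move: {2}(size p) (leqnn (size p)) => m.
elim: m p => [|m IH] p; first by rewrite leqn0 size_poly_eq0 => ->.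
move=> pm p0 px0.
have /closed_rootP[z /factor_theorem[q pE]] : size p != 1%N.
  apply: contraNneq x0 => p1; have /size_poly1P[c c0 pc] : size p == 1%N by rewrite p1.
  move: px0; rewrite pc /poly_act size_polyC c0 big_ord1 coefC /= => /eqP.
  by rewrite scaler_eq0 (negPf c0).
have q0 : q != 0 by apply: contraNneq p0 => q0; rewrite pE q0 mul0r.
have [qx0|qx] := eqVneq (poly_act q) 0.
  by apply: IH qx0 => //; move: pm; rewrite pE size_Mmonic ?monicXsubC // size_XsubC addn2.
exists q, z; split=> //; apply/eqP; rewrite -subr_eq0.
by rewrite -poly_act_subXc -pE px0.
Qed.

(** The vector is annihilated by [X^j - X^i] at [T], and the eigenvector is a
    combination of iterates of [x]. *)
Lemma eigenvector_in (W : set V) i j : is_subspace W ->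
  (forall y, W y -> W (T y)) -> W x -> x != 0 -> (i < j)%N ->
  iter i T x = iter j T x -> exists y z, [/\ y != 0, W y & T y = z *: y].
Proof.
move=> sW TW Wx x0 ij Tij.
have [||q [z [q0 qz]]] := poly_act_eigen (p := 'X^j - 'X^i) x0.
- by rewrite -size_poly_eq0 size_polyDl ?size_polyXn // size_polyN size_polyXn.
- rewrite (poly_actw (m := j.+1)); last first.
    by rewrite size_polyDl ?size_polyXn // size_polyN size_polyXn.
  rewrite (bigD1 (Ordinal (ltnW ij : (i < j.+1)%N))) // (bigD1 ord_max) /=; last first.
    by rewrite -val_eqE /= gtn_eqF.
  rewrite big1 => [|k /andP[ki kj]].
    rewrite !coefB !coefXn !eqxx (ltn_eqF ij) (gtn_eqF ij) Tij.
    by rewrite addr0 sub0r subr0 scale1r scaleN1r addNr.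
  rewrite coefB !coefXn; move: ki kj; rewrite -!val_eqE /=.
  by move=> /negPf -> /negPf ->; rewrite subrr scale0r.
exists (poly_act q), z; split=> //; apply: (subspace_sum sW) => k _.
by apply: (subspaceZ sW); elim: (k : nat) => //= l; apply: TW.
Qed.

End Eigenvector.

Section DegreeBound.
Variables (F : closedFieldType) (G : groupType) (V : gmodule F G) (C : set G).
Hypothesis C1 : C 1%g.
Hypothesis CM : forall x y, C x -> C y -> C (x * y)%g.
Hypothesis Cfin : finite_set C.
Hypothesis Cab : forall x y, C x -> C y -> (x * y = y * x)%g.

Lemma finite_order g : C g -> exists i j, (i < j)%N /\ (g ^+ i = g ^+ j)%g.
Proof.
move=> Cg; apply: contrapT => H.
have inj : injective (fun i => g ^+ i)%g.
  move=> i j gij; case: (ltngtP i j) => // ij; case: H; first by exists i, j.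
  by exists j, i.
apply: infinite_nat; have : finite_set (range (fun i => g ^+ i)%g).
  apply: sub_finite_set Cfin => _ [i _ <-].
  by elim: i => [|i IH]; rewrite ?expg0 // expgS; apply: CM.
exact: card_le_finite (inj_card_le _ inj).
Qed.

(** The joint eigenvectors of the elements treated so far, for their fixed
    eigenvalues, form a subspace that is stable under the next element. *)
Lemma common_eigenvector (s : seq G) : (exists x : V, x != 0) ->
  {in s, forall g, C g} ->
  exists2 x : V, x != 0 & {in s, forall g, exists a, gact g x = a *: x}.
Proof.
move=> nz; elim: s => [|g s IH] sC; first by case: nz => x x0; exists x.
have [|x x0 xs] := IH; first by move=> k ks; apply: sC; rewrite inE ks orbT.
have Cg : C g by apply: sC; rewrite mem_head.
(* The eigenvalues of the elements of [s] on [x], with default value 0. *)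
pose a k : F := if pselect (exists a, gact k x = a *: x) is left H
  then projT1 (cid H) else 0.
have aE k : k \in s -> gact k x = a k *: x.
  by rewrite /a => /xs ak; case: pselect => // H; exact: projT2 (cid H).
pose W := [set y : V | {in s, forall k, gact k y = a k *: y}].
have iterE m : iter m (gact g) x = gact (g ^+ m)%g x.
  by elim: m => [|m IHm]; rewrite ?expg0 ?gact1 // expgS gactM -IHm.
have [i [j [ij gij]]] := finite_order Cg.
have [||//|//|//||y [z [y0 Wy yz]]] :=
  @eigenvector_in _ _ (gact g) x W i j.
- split=> [k ks|b u v Wu Wv k ks]; first by rewrite linear0 scaler0.
  by rewrite gact_linear Wu // Wv // scalerDr !scalerA mulrC.
- move=> y Wy k ks; rewrite -gactM -Cab //; last by apply: sC; rewrite inE ks orbT.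
  by rewrite gactM Wy // gactZ.
- by rewrite [LHS]iterE [RHS]iterE gij.
exists y => // k; rewrite inE => /predU1P[->|ks]; first by exists z.
by exists (a k); apply: Wy.
Qed.

Variables (J : choiceType) (ell : J -> G).
Hypothesis Jfin : finite_set [set: J].
Hypothesis decomp : forall g, exists j c, C c /\ g = (ell j * c)%g.

(** The translates by [ell j] of a common eigenvector of [C] span a submodule, as
    each element of [G] is some [ell j] times an element of [C]. *)
Lemma irreducible_dim_le : irreducible V -> dim_le V [set: J].
Proof.
move=> [nz irr]; have /finite_seqP[s sE] := Cfin.
have [|w w0 wE] := common_eigenvector (s := s) nz.
  by move=> g gs; rewrite sE.
have {}wE c : C c -> exists a, gact c w = a *: w by rewrite sE => /wE.
pose f j := gact (ell j) w.
have sS := lspan_subspace (range f).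
have orbit g : lspan (range f) (gact g w).
  have [j [c [/wE[a ca] ->]]] := decomp g; rewrite gactM ca gactZ.
  by apply: (subspaceZ sS); apply: lspan_sub; exists j.
apply: (dim_le_range (f := f)); first exact: finite_image.
case: (irr (lspan (range f))) => // [g x|S0].
  move=> /(_ [set x | lspan (range f) (gact g x)]); apply.
    split=> [|a u v Su Sv] /=; first by rewrite linear0; case: sS.
    by rewrite gact_linear; apply: sS.2.
  by move=> _ [j _ <-] /=; rewrite /f -gactM.
by have := orbit 1%g; rewrite S0 /= gact1 => /eqP; rewrite (negPf w0).
Qed.

End DegreeBound.

Lemma finite_matrix (T : nzRingType) p q :
  finite_set [set: T] -> finite_set [set: 'M[T]_(p, q)].
Proof.
move=> /finite_fsetP[X XE]; have inX (a : T) : a \in X.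
  by have : [set: T] a by []; rewrite XE.
apply/finite_seqP; exists [seq map_mx val B | B <- enum {: 'M[X]_(p, q)}].
apply/seteqP; split=> // B _ /=; apply/mapP.
exists (map_mx (fun a => [` inX a]%fset) B); first by rewrite mem_enum.
by apply/matrixP=> i j; rewrite !mxE.
Qed.

Lemma finite_CinP (A : nzRingType) (star : ring_involution A) n :
  finite_set [set: A] -> finite_set (CinP star n).
Proof.
move=> Afin; pose f (g : Pgrp star n) := glval (pval g).
have finj : injective f by move=> g g' /val_inj/val_inj.
apply: card_le_finite (finite_matrix (n + n) (n + n) Afin).
apply: card_le_trans (subset_card_le (subsetT (f @` CinP star n))).
exact: inj_card_le finj.
Qed.

Theorem mainTheorem2 (A : nzRingType) (star : ring_involution A) (n : nat)
    (hn : (0 < n)%N) :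
  (forall F : fieldType,
    (forall lam : 'I_n -> A -> F,
      (forall i, left_admissible star (lam i)) ->
      [/\ irreducible (VD star [set: 'I_n]%SET lam),
          dim_eq (VD star [set: 'I_n]%SET lam) [set: 'rV[A]_((n * n.-1)./2)],
          normal_abelian_subgroup (CinP star n) &
          lcosets (CinP star n) #= [set: 'rV[A]_((n * n.-1)./2)]]) /\
    ((forall r : A, star r = r -> exists a : A, r = a + star a) ->
     forall lam lam' : 'I_n -> A -> F,
      (forall i, left_admissible star (lam i)) ->
      (forall i, left_admissible star (lam' i)) ->
      (exists (i : 'I_n) (r : A), star r = r /\ lam i r <> lam' i r) ->
      ~ isomorphic (VD star [set: 'I_n]%SET lam)
                   (VD star [set: 'I_n]%SET lam'))) /\
  (finite_set [set: A] ->
   forall (R : realType) (lam : 'I_n -> A -> R[i]),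
    (forall i, left_admissible star (lam i)) ->
    [/\ irreducible (VD star [set: 'I_n]%SET lam),
        dim_eq (VD star [set: 'I_n]%SET lam) [set: 'rV[A]_((n * n.-1)./2)] &
        forall W : gmodule R[i] (Pgrp star n),
          irreducible W -> dim_le W [set: 'rV[A]_((n * n.-1)./2)]]).
Proof.
rewrite -card_above_diag; split=> [F|Afin R lam adm].
  split=> [lam adm|_ lam lam' adm adm' [i [r [rr neq]]] iso].
    split.
    - exact: VD_full_irreducible.
    - exact: VD_full_dim.
    - exact: CinP_normal_abelian.
    - exact: card_lcosets_C.
  by case: neq; apply: VD_full_isomorphic iso i r rr.
split; [exact: VD_full_irreducible|exact: VD_full_dim|].
move=> W; apply: (irreducible_dim_le _ _ (finite_CinP star n Afin) _ _
  (@ell_decomp _ star n)).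
- exact: Cgrp1.
- by move=> x y; apply: CgrpM.
- exact: CinP_abelian.
- exact: finite_matrix.
Qed.
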